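(* Let $\mathcal A'$ be the unital associative $\mathbb K$-algebra defined by generators $\nu_x,\nu_y,\nu_z$ and the following twelve relations: \begin{align*} q^3 \nu_x^2\nu_y-(q+q^{-1})\nu_x\nu_y\nu_x + q^{-3}\nu_y\nu_x^2 &= (q^2-q^{-2})(q-q^{-1})\nu_x,\\ q^3 \nu_y^2\nu_z-(q+q^{-1})\nu_y\nu_z\nu_y + q^{-3}\nu_z\nu_y^2 &= (q^2-q^{-2})(q-q^{-1})\nu_y,\\ q^3 \nu_z^2\nu_x-(q+q^{-1})\nu_z\nu_x\nu_z + q^{-3}\nu_x\nu_z^2 &= (q^2-q^{-2})(q-q^{-1})\nu_z,\\ q^{-3} \nu_y^2\nu_x-(q+q^{-1})\nu_y\nu_x\nu_y + q^{3}\nu_x\nu_y^2 &= (q^2-q^{-2})(q-q^{-1})\nu_y,\\ q^{-3} \nu_z^2\nu_y-(q+q^{-1})\nu_z\nu_y\nu_z + q^{3}\nu_y\nu_z^2 &= (q^2-q^{-2})(q-q^{-1})\nu_z,\\ q^{-3} \nu_x^2\nu_z-(q+q^{-1})\nu_x\nu_z\nu_x + q^{3}\nu_z\nu_x^2 &= (q^2-q^{-2})(q-q^{-1})\nu_x,\\ \nu_x \frac{q\nu_y\nu_z - q^{-1}\nu_z\nu_y}{q-q^{-1}} &= \nu_x - q^{-2}\nu_y - q^2\nu_z + \frac{q^2\nu_y\nu_z-q^{-2}\nu_z\nu_y}{q-q^{-1}},\\ \nu_y \frac{q\nu_z\nu_x - q^{-1}\nu_x\nu_z}{q-q^{-1}}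 &= \nu_y - q^{-2}\nu_z - q^2\nu_x + \frac{q^2\nu_z\nu_x-q^{-2}\nu_x\nu_z}{q-q^{-1}},\\ \nu_z \frac{q\nu_x\nu_y - q^{-1}\nu_y\nu_x}{q-q^{-1}} &= \nu_z - q^{-2}\nu_x - q^2\nu_y + \frac{q^2\nu_x\nu_y-q^{-2}\nu_y\nu_x}{q-q^{-1}},\\ \frac{q\nu_y\nu_z - q^{-1}\nu_z\nu_y}{q-q^{-1}}\nu_x &= \nu_x - q^{2}\nu_y - q^{-2}\nu_z + \frac{q^2\nu_y\nu_z-q^{-2}\nu_z\nu_y}{q-q^{-1}},\\ \frac{q\nu_z\nu_x - q^{-1}\nu_x\nu_z}{q-q^{-1}}\nu_y &= \nu_y - q^{2}\nu_z - q^{-2}\nu_x + \frac{q^2\nu_z\nu_x-q^{-2}\nu_x\nu_z}{q-q^{-1}},\\ \frac{q\nu_x\nu_y - q^{-1}\nu_y\nu_x}{q-q^{-1}}\nu_z &= \nu_z - q^{2}\nu_x - q^{-2}\nu_y + \frac{q^2\nu_x\nu_y-q^{-2}\nu_y\nu_x}{q-q^{-1}}. \end{align*} Then the $\mathbb K$-algebras $\mathcal A'$ and $\mathcal A$ are isomorphic. An isomorphism $\mathcal A'\to\mathcal A$ is given by sending, for each $\eta\in\{x,y,z\}$, the generator $\nu_\eta$ of $\mathcal A'$ to the element $\nu_\eta$ of $\mathcal A\subseteq U_q(\mathfrak{sl}_2)$.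
   Context: $\mathbb K$ is a field and $q$ is a nonzero scalar in $\mathbb K$ with $q^2\neq 1$. $\mathbb N=\{0,1,2,\ldots\}$. $U_q(\mathfrak{sl}_2)$ is the unital associative $\mathbb K$-algebra with generators $x,y,y^{-1},z$ and relations $yy^{-1}=y^{-1}y=1$, $\frac{qxy-q^{-1}yx}{q-q^{-1}}=1$, $\frac{qyz-q^{-1}zy}{q-q^{-1}}=1$, $\frac{qzx-q^{-1}xz}{q-q^{-1}}=1$. (Known: the elements $x^ry^sz^t$ with $r,t\in\mathbb N$, $s\in\mathbb Z$ form a $\mathbb K$-basis of it.) $\mathcal A$ is the $\mathbb K$-subspace of $U_q(\mathfrak{sl}_2)$ spanned by $x^ry^sz^t$ with $r,s,t\in\mathbb N$ and $r+s+t$ even; it is a (unital) $\mathbb K$-subalgebra. In $U_q(\mathfrak{sl}_2)$ set $\nu_x=q(1-yz)=q^{-1}(1-zy)$, $\nu_y=q(1-zx)=q^{-1}(1-xz)$, $\nu_z=q(1-xy)=q^{-1}(1-yx)$. These elements lie in $\mathcal A$ (and are known to generate it). *)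

(* Defs.v *)
From HB Require Import structures.
From mathcomp Require Import all_boot all_order all_algebra.
From mathcomp Require Import boolp finmap.
From mathcomp.multinomials Require Import monalg.

Set Implicit Arguments.
Unset Strict Implicit.
Unset Printing Implicit Defensive.

Import GRing.Theory.
Local Open Scope ring_scope.
Local Open Scope quotient_scope.

(* The free unital associative K-algebra on n generators, as the monoid       *)
(* algebra of the free monoid on 'I_n.                                        *)
Notation free_alg K n := {malg K[{fmonom 'I_n}]}.

Section MonoidAlgebra.
Variables (M : monomType) (R : comNzRingType).

Lemma malg_scalerAr (k : R) (a b : {malg R[M]}) : k *: (a * b) = a * (k *: b).
Proof.
apply/malgP => m; rewrite mcoeffZ mcoeffMl.
rewrite (mcoeffMlw _ (fsubset_refl _) (msuppZ_le k b)) mulr_sumr.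
apply: eq_bigr => i _; rewrite mulr_sumr; apply: eq_bigr => j _.
by rewrite mcoeffZ mulrnAr mulrCA.
Qed.

End MonoidAlgebra.

Section FreeAlgebra.
Variables (K : fieldType) (n : nat).

Definition free_gen (i : 'I_n) : free_alg K n := << fmu i >>.

Section Eval.
Variables (B : algType K) (b : 'I_n -> B).

Definition word_eval (w : {fmonom 'I_n}) : B := \prod_(i <- (w : seq _)) b i.

Fact word_eval_mmorphism : mmorphism word_eval.
Proof. by split=> [v w|]; rewrite /word_eval ?fmM ?big_cat // fm1 big_nil. Qed.

HB.instance Definition _ :=
  isMultiplicative.Build {fmonom 'I_n} B word_eval word_eval_mmorphism.

Definition free_eval : free_alg K n -> B := mmap (in_alg B) word_eval.

HB.instance Definition _ := GRing.Additive.on free_eval.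

Fact free_eval_monoid_morphism : monoid_morphism free_eval.
Proof.
have [fM f1] : multiplicative free_eval.
  apply: commr_mmap_is_multiplicative => g m m'.
  by rewrite /GRing.comm mulr_algl mulr_algr.
by split.
Qed.

HB.instance Definition _ :=
  GRing.isMonoidMorphism.Build (free_alg K n) B free_eval
    free_eval_monoid_morphism.

Fact free_eval_scalable : scalable free_eval.
Proof. by move=> k a; rewrite /free_eval mmapZ mulr_algl. Qed.

HB.instance Definition _ :=
  GRing.isScalable.Build K (free_alg K n) B *:%R free_eval free_eval_scalable.

Lemma free_evalE i : free_eval (free_gen i) = b i.
Proof.
by rewrite /free_eval /free_gen mmapU /= scale1r mul1r /word_eval fmU big_seq1.
Qed.

End Eval.
End FreeAlgebra.

Inductive ideal_gen (R : nzRingType) (S : R -> Prop) : R -> Prop :=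
| ideal_gen_incl a : S a -> ideal_gen S a
| ideal_gen0 : ideal_gen S 0
| ideal_genB a b : ideal_gen S a -> ideal_gen S b -> ideal_gen S (a - b)
| ideal_genMl a b : ideal_gen S b -> ideal_gen S (a * b)
| ideal_genMr a b : ideal_gen S a -> ideal_gen S (a * b).

Section PresentedAlgebra.
Variables (K : fieldType) (n : nat).
Local Notation F := (free_alg K n).
Variable rels : seq (F * F).

(* A relation u = v is encoded as the pair (u, v). *)
Definition rel_ideal : F -> Prop :=
  ideal_gen (fun a => exists2 r, r \in rels & a = r.1 - r.2).

Definition in_rel_ideal : {pred F} := [pred a | `[< rel_ideal a >]].

Lemma in_rel_idealP a : reflect (rel_ideal a) (a \in in_rel_ideal).
Proof. exact: asboolP. Qed.

Fact in_rel_ideal_zmod_closed : zmod_closed in_rel_ideal.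
Proof.
split; first exact/in_rel_idealP/ideal_gen0.
by move=> a b /in_rel_idealP Ia /in_rel_idealP Ib; apply/in_rel_idealP/ideal_genB.
Qed.

HB.instance Definition _ :=
  GRing.isZmodClosed.Build F in_rel_ideal in_rel_ideal_zmod_closed.

Lemma in_rel_idealMl a b : b \in in_rel_ideal -> a * b \in in_rel_ideal.
Proof. by move=> /in_rel_idealP Ib; apply/in_rel_idealP/ideal_genMl. Qed.

Lemma in_rel_idealMr a b : a \in in_rel_ideal -> a * b \in in_rel_ideal.
Proof. by move=> /in_rel_idealP Ia; apply/in_rel_idealP/ideal_genMr. Qed.

Lemma free_eval_rel_ideal (B : algType K) (b : 'I_n -> B) :
    {in rels, forall r, free_eval b r.1 = free_eval b r.2} ->
  forall a, rel_ideal a -> free_eval b a = 0.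
Proof.
move=> brel a; elim=> {a} [a [r /brel br ->]||a c _ a0 _ c0|a c _ c0|a c _ a0].
- by rewrite rmorphB /= br subrr.
- by rewrite rmorph0.
- by rewrite rmorphB /= a0 c0 subrr.
- by rewrite rmorphM /= c0 mulr0.
- by rewrite rmorphM /= a0 mul0r.
Qed.

Lemma rel_ideal_proper (B : algType K) (b : 'I_n -> B) :
    {in rels, forall r, free_eval b r.1 = free_eval b r.2} ->
  ~ rel_ideal 1.
Proof.
move=> brel /(free_eval_rel_ideal brel)/eqP.
by rewrite rmorph1 oner_eq0.
Qed.

(* The argument, a proof that the ideal is proper, is needed because an       *)
(* algType is a nonzero ring.                                                 *)
Definition pres_alg of ~ rel_ideal 1 := Quotient.quot in_rel_ideal.

Variable nz : ~ rel_ideal 1.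
Local Notation A := (pres_alg nz).

HB.instance Definition _ := GRing.Zmodule.on A.
HB.instance Definition _ : EqQuotient F (Quotient.equiv in_rel_ideal) A :=
  EqQuotient.on A.

Lemma pres_eqP (a b : F) : reflect (\pi_A a = \pi_A b) (a - b \in in_rel_ideal).
Proof. by rewrite (Quotient.idealrBE in_rel_ideal); apply: eqP. Qed.

Lemma pi_presB : {morph \pi_A : a b / a - b}.
Proof.
move=> a b; apply: etrans (Quotient.pi_add in_rel_ideal a (- b)) _.
by congr (_ + _); apply: (Quotient.pi_opp in_rel_ideal b).
Qed.

Lemma pi_presD : {morph \pi_A : a b / a + b}.
Proof. exact: (Quotient.pi_add in_rel_ideal). Qed.

Definition pres_one : A := lift_cst A 1.
Definition pres_mul : A -> A -> A := lift_op2 A *%R.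
Definition pres_scale (k : K) : A -> A := lift_op1 A ( *:%R k).

Lemma pi_pres1 : \pi_A 1 = pres_one.
Proof. by rewrite /pres_one; unlock. Qed.

Lemma repr_pi (a : F) : repr (\pi_A a) - a \in in_rel_ideal.
Proof. by apply/pres_eqP; rewrite reprK. Qed.

Lemma pi_presM : {morph \pi_A : a b / a * b >-> pres_mul a b}.
Proof.
move=> a b; rewrite /pres_mul; unlock; apply/esym/pres_eqP.
rewrite -[X in X - _](subrK (repr (\pi_A a) * b)) -mulrBr -addrA -mulrBl.
by apply: rpredD; [apply: in_rel_idealMl | apply: in_rel_idealMr]; apply: repr_pi.
Qed.

Lemma pi_presZ k : {morph \pi_A : a / k *: a >-> pres_scale k a}.
Proof.
move=> a; rewrite /pres_scale; unlock; apply/esym/pres_eqP.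
by rewrite -scalerBr -mul_malgC in_rel_idealMl ?repr_pi.
Qed.

Fact pres_mulA : associative pres_mul.
Proof.
move=> u v w; rewrite -[u]reprK -[v]reprK -[w]reprK.
move: (repr u) (repr v) (repr w) => a b c.
by rewrite -(pi_presM b c) -(pi_presM a b) -(pi_presM a) -pi_presM mulrA.
Qed.

Fact pres_mul1l : left_id pres_one pres_mul.
Proof. by move=> u; rewrite -[u]reprK -pi_pres1 -pi_presM mul1r. Qed.

Fact pres_mul1r : right_id pres_one pres_mul.
Proof. by move=> u; rewrite -[u]reprK -pi_pres1 -pi_presM mulr1. Qed.

Fact pres_mulDl : left_distributive pres_mul +%R.
Proof.
move=> u v w; rewrite -[u]reprK -[v]reprK -[w]reprK.
move: (repr u) (repr v) (repr w) => a b c.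
by rewrite -pi_presD -(pi_presM a c) -(pi_presM b c) -pi_presM mulrDl pi_presD.
Qed.

Fact pres_mulDr : right_distributive pres_mul +%R.
Proof.
move=> u v w; rewrite -[u]reprK -[v]reprK -[w]reprK.
move: (repr u) (repr v) (repr w) => a b c.
by rewrite -pi_presD -(pi_presM a b) -(pi_presM a c) -pi_presM mulrDr pi_presD.
Qed.

Fact pres_one_neq0 : pres_one != 0.
Proof.
apply/eqP => e; apply: nz; apply/in_rel_idealP; rewrite -[1]subr0.
by apply/pres_eqP; rewrite pi_pres1 e -(subrr (0 : F)) pi_presB subrr.
Qed.

HB.instance Definition _ := GRing.Zmodule_isNzRing.Build A
  pres_mulA pres_mul1l pres_mul1r pres_mulDl pres_mulDr pres_one_neq0.

Fact pres_scalerA k l (u : A) :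
  pres_scale k (pres_scale l u) = pres_scale (k * l) u.
Proof.
rewrite -[u]reprK; move: (repr u) => a.
by rewrite -(pi_presZ l a) -(pi_presZ _ a) -pi_presZ scalerA.
Qed.

Fact pres_scale1r : left_id 1 pres_scale.
Proof. by move=> u; rewrite -[u]reprK -(pi_presZ 1) scale1r. Qed.

Fact pres_scalerDr : right_distributive pres_scale +%R.
Proof.
move=> k u v; rewrite -[u]reprK -[v]reprK; move: (repr u) (repr v) => a b.
by rewrite -pi_presD -(pi_presZ k a) -(pi_presZ k b) -pi_presZ scalerDr pi_presD.
Qed.

Fact pres_scalerDl (u : A) : {morph pres_scale^~ u : k l / k + l}.
Proof.
move=> k l /=; rewrite -[u]reprK; move: (repr u) => a.
by rewrite -(pi_presZ k a) -(pi_presZ l a) -(pi_presZ _ a) scalerDl pi_presD.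
Qed.

HB.instance Definition _ := GRing.Zmodule_isLmodule.Build K A
  pres_scalerA pres_scale1r pres_scalerDr pres_scalerDl.

Fact pres_scalerAl k (u v : A) : k *: (u * v) = (k *: u) * v.
Proof.
change (pres_scale k (pres_mul u v) = pres_mul (pres_scale k u) v).
rewrite -[u]reprK -[v]reprK; move: (repr u) (repr v) => a b.
by rewrite -(pi_presM a b) -(pi_presZ k a) -pi_presZ -pi_presM scalerAl.
Qed.

HB.instance Definition _ := GRing.Lmodule_isLalgebra.Build K A pres_scalerAl.

Fact pres_scalerAr k (u v : A) : k *: (u * v) = u * (k *: v).
Proof.
change (pres_scale k (pres_mul u v) = pres_mul u (pres_scale k v)).
rewrite -[u]reprK -[v]reprK; move: (repr u) (repr v) => a b.
by rewrite -(pi_presM a b) -(pi_presZ k b) -pi_presZ -pi_presM malg_scalerAr.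
Qed.

HB.instance Definition _ := GRing.Lalgebra_isAlgebra.Build K A pres_scalerAr.

Definition pres_pi : F -> A := \pi_A.

Fact pres_pi_zmod_morphism : zmod_morphism pres_pi.
Proof. exact: pi_presB. Qed.

HB.instance Definition _ :=
  GRing.isZmodMorphism.Build F A pres_pi pres_pi_zmod_morphism.

Fact pres_pi_monoid_morphism : monoid_morphism pres_pi.
Proof. by split; [exact: pi_pres1 | exact: pi_presM]. Qed.

HB.instance Definition _ :=
  GRing.isMonoidMorphism.Build F A pres_pi pres_pi_monoid_morphism.

HB.instance Definition _ :=
  GRing.isScalable.Build K F A *:%R pres_pi pi_presZ.

Definition pres_gen (i : 'I_n) : A := pres_pi (free_gen K i).

Lemma pres_rel r : r \in rels -> pres_pi r.1 = pres_pi r.2.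
Proof.
by move=> rr; apply/pres_eqP/in_rel_idealP/ideal_gen_incl; exists r.
Qed.

End PresentedAlgebra.

Section Span.
Variables (K : fieldType) (V : lmodType K) (S : V -> Prop).

Definition in_span : {pred V} :=
  [pred v | `[< exists2 s : seq (K * V),
                  {in s, forall p, S p.2} & v = \sum_(p <- s) p.1 *: p.2 >]].

Lemma in_spanP v :
  reflect (exists2 s : seq (K * V),
             {in s, forall p, S p.2} & v = \sum_(p <- s) p.1 *: p.2)
          (v \in in_span).
Proof. exact: asboolP. Qed.

Lemma mem_in_span v : S v -> v \in in_span.
Proof.
move=> Sv; apply/in_spanP; exists [:: (1, v)]; last by rewrite big_seq1 scale1r.
by move=> p; rewrite inE => /eqP->.
Qed.

Lemma in_span_subsemimod_closed : GRing.subsemimod_closed in_span.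
Proof.
split; last first.
  move=> k v /in_spanP[s sS ->]; apply/in_spanP.
  exists [seq (k * p.1, p.2) | p <- s]; first by move=> _ /mapP[p /sS ? ->].
  by rewrite big_map scaler_sumr; apply: eq_bigr => p _; rewrite scalerA.
split; first by apply/in_spanP; exists [::]; rewrite ?big_nil.
move=> u v /in_spanP[s sS ->] /in_spanP[t tS ->].
apply/in_spanP; exists (s ++ t); last by rewrite big_cat.
by move=> p; rewrite mem_cat => /orP[/sS|/tS].
Qed.

Lemma in_spanD : {in in_span &, forall u v, u + v \in in_span}.
Proof. exact: in_span_subsemimod_closed.1.2. Qed.

Lemma in_spanZ k : {in in_span, forall v, k *: v \in in_span}.
Proof. exact: in_span_subsemimod_closed.2. Qed.

Lemma in_span_ind (W : lmodType K) (f : V -> W) (P : {pred W}) :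
    linear f -> GRing.subsemimod_closed P -> (forall v, S v -> f v \in P) ->
  {in in_span, forall v, f v \in P}.
Proof.
move=> lf [[P0 PD] PZ] fP v /in_spanP[s sS ->].
have f0 : f 0 = 0.
  by have /eqP := lf 1 0 0; rewrite !scale1r addr0 -subr_eq subrr eq_sym => /eqP.
elim: s sS => [_|p s IHs sS]; first by rewrite big_nil f0.
rewrite big_cons lf; apply: PD; first by apply/PZ/fP/sS/mem_head.
by apply: IHs => r rs; apply: sS; rewrite inE rs orbT.
Qed.

End Span.

(* In an algebra with y x = a x y + b, z x = a' x z + b', z y = a'' y z + b'', *)
(* the product of monomials x^r y^s z^t whose total degrees have parities p   *)
(* and p' is in the span of those of parity p (+) p'.                         *)
Section MonomialSpan.
Variables (K : fieldType) (B : algType K) (x y z : B).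
Hypotheses (yx : exists a b : K, y * x = a *: (x * y) + b%:A)
           (zx : exists a b : K, z * x = a *: (x * z) + b%:A)
           (zy : exists a b : K, z * y = a *: (y * z) + b%:A).

Definition xyz_monomial (p : bool) (u : B) : Prop :=
  exists r s t : nat, odd (r + s + t) = p /\ u = x ^+ r * y ^+ s * z ^+ t.

Local Notation E p := (in_span (xyz_monomial p)).

Lemma mull_linear (c : B) : linear ( *%R c).
Proof. by move=> k u v; rewrite mulrDr scalerAr. Qed.

Lemma mulr_linear (c : B) : linear ( *%R^~ c).
Proof. by move=> k u v; rewrite mulrDl scalerAl. Qed.

Lemma xyz_span_mull_ind c p p' :
    (forall r s t, odd (r + s + t) = p ->
       c * (x ^+ r * y ^+ s * z ^+ t) \in E p') ->
  {in E p, forall u, c * u \in E p'}.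
Proof.
move=> cE; apply: in_span_ind (mull_linear c) _ _.
  exact: in_span_subsemimod_closed.
by move=> _ [r [s [t [rst ->]]]]; apply: cE.
Qed.

Lemma xyz_span_monomial r s t p :
  odd (r + s + t) = p -> x ^+ r * y ^+ s * z ^+ t \in E p.
Proof. by move=> rst; apply: mem_in_span; exists r, s, t. Qed.

Lemma xyz_span_mulx p : {in E p, forall u, x * u \in E (~~ p)}.
Proof.
apply: xyz_span_mull_ind => r s t rst; rewrite !mulrA -exprS; apply: xyz_span_monomial.
by rewrite !addSn /= rst.
Qed.

Lemma xyz_span_muly p : {in E p, forall u, y * u \in E (~~ p)}.
Proof.
apply: xyz_span_mull_ind => r s t; have [k [l yxE]] := yx.
elim: r p => [|r IHr] p rst.
  rewrite expr0 mul1r mulrA -exprS -[_ ^+ _]mul1r -(expr0 x).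
  by apply: xyz_span_monomial; rewrite -rst.
rewrite exprS -!mulrA mulrA yxE mulrDl -scalerAl mulr_algl -mulrA.
rewrite !(mulrA (x ^+ r)); apply: in_spanD; apply: in_spanZ.
  have {1}-> : p = ~~ ~~ p by rewrite negbK.
  by apply/xyz_span_mulx/IHr; rewrite -rst !addSn /= negbK.
by apply: xyz_span_monomial; rewrite -rst !addSn /= negbK.
Qed.

Lemma xyz_span_mulz p : {in E p, forall u, z * u \in E (~~ p)}.
Proof.
apply: xyz_span_mull_ind => r s t; have [k [l zxE]] := zx; have [k' [l' zyE]] := zy.
elim: r p => [|r IHr] p rst.
  elim: s p rst => [|s IHs] p rst.
    rewrite expr0 !mul1r -exprS -[_ ^+ _]mul1r -[1]mulr1.
    by rewrite -{1}(expr0 x) -(expr0 y); apply: xyz_span_monomial; rewrite -rst.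
  rewrite expr0 mul1r exprS -!mulrA mulrA zyE mulrDl -scalerAl mulr_algl -mulrA.
  have e : y ^+ s * z ^+ t = x ^+ 0 * y ^+ s * z ^+ t by rewrite expr0 mul1r.
  rewrite e; apply: in_spanD; apply: in_spanZ.
    have {1}-> : p = ~~ ~~ p by rewrite negbK.
    by apply/xyz_span_muly/IHs; rewrite -rst !addnS !addSn /= negbK.
  by apply: xyz_span_monomial; rewrite -rst !addnS !addSn /= negbK.
rewrite exprS -!mulrA mulrA zxE mulrDl -scalerAl mulr_algl -mulrA.
rewrite !(mulrA (x ^+ r)); apply: in_spanD; apply: in_spanZ.
  have {1}-> : p = ~~ ~~ p by rewrite negbK.
  by apply/xyz_span_mulx/IHr; rewrite -rst !addSn /= negbK.
by apply: xyz_span_monomial; rewrite -rst !addSn /= negbK.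
Qed.

Lemma xyz_span_mul p p' :
  {in E p & E p', forall u v, u * v \in E (p (+) p')}.
Proof.
move=> u v uE vE.
have mulX (c : B) n p1 w :
    (forall p, {in E p, forall u, c * u \in E (~~ p)}) ->
  w \in E p1 -> c ^+ n * w \in E (odd n (+) p1).
  move=> cE wE; elim: n => [|n IHn]; first by rewrite mul1r.
  by rewrite exprS -mulrA /= addNb; apply: cE.
apply: (in_span_ind (mulr_linear v) (in_span_subsemimod_closed _) _ uE).
move=> _ [r [s [t [<- ->]]]]; rewrite -!mulrA !oddD -!addbA.
exact: mulX xyz_span_mulx (mulX _ _ _ _ xyz_span_muly (mulX _ _ _ _ xyz_span_mulz vE)).
Qed.

Lemma xyz_span1 : 1 \in E false.
Proof. by have := @xyz_span_monomial 0 0 0 false erefl; rewrite !mulr1. Qed.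

End MonomialSpan.

Definition qbracket (K : fieldType) (B : lalgType K) (q c : K) (a b : B) : B :=
  (q - q^-1)^-1 *: (c *: (a * b) - c^-1 *: (b * a)).

Lemma rmorph_qbracket (K : fieldType) (B C : lalgType K)
    (f : {lrmorphism B -> C}) (q c : K) (a b : B) :
  f (qbracket q c a b) = qbracket q c (f a) (f b).
Proof. by rewrite /qbracket linearZ_LR rmorphB /= !linearZ_LR !rmorphM. Qed.

Definition Uq_rels (K : fieldType) (B : lalgType K) (q : K) (x y yV z : B) :
    seq (B * B) :=
  [:: (y * yV, 1);
      (yV * y, 1);
      (qbracket q q x y, 1);
      (qbracket q q y z, 1);
      (qbracket q q z x, 1)].

Lemma map_Uq_rels (K : fieldType) (B C : lalgType K) (f : {lrmorphism B -> C})
    (q : K) (x y yV z : B) :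
  [seq (f r.1, f r.2) | r <- Uq_rels q x y yV z] =
  Uq_rels q (f x) (f y) (f yV) (f z).
Proof. by rewrite /Uq_rels /= !rmorph_qbracket !rmorphM rmorph1. Qed.

Lemma Uq_rels_and5 (K : fieldType) (B : lalgType K) (q : K) (x y yV z : B) :
  {in Uq_rels q x y yV z, forall r, r.1 = r.2} ->
  [/\ y * yV = 1, yV * y = 1, qbracket q q x y = 1,
      qbracket q q y z = 1 & qbracket q q z x = 1].
Proof.
move=> E; have{}E u v : (u, v) \in Uq_rels q x y yV z -> u = v by move/E.
by split; apply: E; rewrite !inE eqxx ?orbT.
Qed.

Definition Aprime_rels (K : fieldType) (B : lalgType K) (q : K)
    (nx ny nz : B) : seq (B * B) :=
  let c := (q ^+ 2 - q ^- 2) * (q - q^-1) in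
  let br := qbracket q q in
  let br2 := qbracket q (q ^+ 2) in
  [:: (q ^+ 3 *: (nx ^+ 2 * ny) - (q + q^-1) *: (nx * ny * nx)
         + q ^- 3 *: (ny * nx ^+ 2), c *: nx);
      (q ^+ 3 *: (ny ^+ 2 * nz) - (q + q^-1) *: (ny * nz * ny)
         + q ^- 3 *: (nz * ny ^+ 2), c *: ny);
      (q ^+ 3 *: (nz ^+ 2 * nx) - (q + q^-1) *: (nz * nx * nz)
         + q ^- 3 *: (nx * nz ^+ 2), c *: nz);
      (q ^- 3 *: (ny ^+ 2 * nx) - (q + q^-1) *: (ny * nx * ny)
         + q ^+ 3 *: (nx * ny ^+ 2), c *: ny);
      (q ^- 3 *: (nz ^+ 2 * ny) - (q + q^-1) *: (nz * ny * nz)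
         + q ^+ 3 *: (ny * nz ^+ 2), c *: nz);
      (q ^- 3 *: (nx ^+ 2 * nz) - (q + q^-1) *: (nx * nz * nx)
         + q ^+ 3 *: (nz * nx ^+ 2), c *: nx);
      (nx * br ny nz, nx - q ^- 2 *: ny - q ^+ 2 *: nz + br2 ny nz);
      (ny * br nz nx, ny - q ^- 2 *: nz - q ^+ 2 *: nx + br2 nz nx);
      (nz * br nx ny, nz - q ^- 2 *: nx - q ^+ 2 *: ny + br2 nx ny);
      (br ny nz * nx, nx - q ^+ 2 *: ny - q ^- 2 *: nz + br2 ny nz);
      (br nz nx * ny, ny - q ^+ 2 *: nz - q ^- 2 *: nx + br2 nz nx);
      (br nx ny * nz, nz - q ^+ 2 *: nx - q ^- 2 *: ny + br2 nx ny)].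

Lemma map_Aprime_rels (K : fieldType) (B C : lalgType K)
    (f : {lrmorphism B -> C}) (q : K) (nx ny nz : B) :
  [seq (f r.1, f r.2) | r <- Aprime_rels q nx ny nz] =
  Aprime_rels q (f nx) (f ny) (f nz).
Proof.
have fD u v : f (u + v) = f u + f v by exact: rmorphD.
have fN u : f (- u) = - f u by exact: rmorphN.
have fM u v : f (u * v) = f u * f v by exact: rmorphM.
have fZ k u : f (k *: u) = k *: f u by exact: linearZ_LR.
have fq c u v : f (qbracket q c u v) = qbracket q c (f u) (f v).
  exact: rmorph_qbracket.
by rewrite /Aprime_rels /= !expr2 !(fD, fN, fM, fZ, fq).
Qed.

Lemma qbracket00 (K : fieldType) (B : lalgType K) (q c : K) :
  qbracket q c 0 0 = 0 :> B.
Proof. by rewrite /qbracket mulr0 !scaler0 subr0 scaler0. Qed.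

Section Aprime.
Variables (K : fieldType) (q : K).
Local Notation X i := (free_gen K (i : 'I_3)).

Definition Aprime_presentation : seq (free_alg K 3 * free_alg K 3) :=
  Aprime_rels q (X 0) (X 1) (X 2).

Lemma Aprime_presentation_eval0 (B : algType K) :
  {in Aprime_presentation, forall r,
     free_eval (fun=> 0 : B) r.1 = free_eval (fun=> 0 : B) r.2}.
Proof.
set f := free_eval _; move=> r /(map_f (fun r => (f r.1, f r.2))).
rewrite map_Aprime_rels /f /= !free_evalE /Aprime_rels !qbracket00.
rewrite !(mulr0, mul0r, scaler0, subr0, addr0) !inE !orbb.
by case/eqP=> -> ->.
Qed.

Lemma Aprime_proper : ~ rel_ideal Aprime_presentation 1.
Proof. exact: rel_ideal_proper (@Aprime_presentation_eval0 K^o). Qed.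

Definition Aprime : algType K := pres_alg Aprime_proper.

Definition Aprime_nu_x : Aprime := pres_gen Aprime_proper 0.
Definition Aprime_nu_y : Aprime := pres_gen Aprime_proper 1.
Definition Aprime_nu_z : Aprime := pres_gen Aprime_proper 2.

End Aprime.

Section Uq.
Variables (K : fieldType) (q : K).
Local Notation X i := (free_gen K (i : 'I_4)).

(* The generators 0, 1, 2, 3 are x, y, y^-1, z. *)
Definition Uq_presentation : seq (free_alg K 4 * free_alg K 4) :=
  Uq_rels q (X 0) (X 1) (X 2) (X 3).

Hypotheses (q0 : q != 0) (q2 : q ^+ 2 != 1).

Lemma subqV_neq0 : q - q^-1 != 0.
Proof.
by rewrite subr_eq0; apply: contra_neq q2 => e; rewrite expr2 {1}e mulVf.
Qed.

Lemma qbracket11 (B : lalgType K) : qbracket q q 1 1 = 1 :> B.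
Proof.
by rewrite /qbracket mulr1 -scalerBl scalerA mulVf ?subqV_neq0 ?scale1r.
Qed.

Lemma qbracket_eq1 (B : lalgType K) (a b : B) :
  qbracket q q a b = 1 -> b * a = q ^+ 2 *: (a * b) + (1 - q ^+ 2)%:A.
Proof.
move=> /(congr1 ( *:%R (q - q^-1))); rewrite scalerA mulfV ?subqV_neq0 // scale1r.
move=> /(congr1 ( *:%R q)); rewrite scalerBr !scalerA -expr2 mulfV // scale1r.
rewrite mulrBr mulfV // -expr2 => e.
by rewrite -[1 - _]opprB scaleNr -e opprB addrC subrK.
Qed.

Lemma qbracket_eq1V (B : lalgType K) (a b : B) : qbracket q q a b = 1 ->
  exists k l : K, a * b = k *: (b * a) + l%:A.
Proof.
move/qbracket_eq1 ->; exists (q ^- 2), (- (q ^- 2 * (1 - q ^+ 2))).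
by rewrite scalerDr !scalerA mulVf ?expf_neq0 // scale1r scaleNr addrK.
Qed.

Lemma nuE (B : lalgType K) (a b : B) :
  qbracket q q a b = 1 -> q *: (1 - a * b) = q^-1 *: (1 - b * a).
Proof.
move=> /qbracket_eq1 ->; rewrite scalerBl scale1r opprD opprB addrCA.
by rewrite [1 + (_ - 1)]addrC subrK [- _ + _]addrC -scalerBr scalerA expr2 mulKf.
Qed.

Lemma Uq_presentation_eval1 (B : algType K) :
  {in Uq_presentation, forall r,
     free_eval (fun=> 1 : B) r.1 = free_eval (fun=> 1 : B) r.2}.
Proof.
set f := free_eval _; move=> r /(map_f (fun r => (f r.1, f r.2))).
rewrite map_Uq_rels /f /= !free_evalE /Uq_rels qbracket11 mulr1 !inE !orbb.
by case/eqP=> -> ->.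
Qed.

Lemma Uq_proper : ~ rel_ideal Uq_presentation 1.
Proof. exact: rel_ideal_proper (@Uq_presentation_eval1 K^o). Qed.

Definition Uq : algType K := pres_alg Uq_proper.

Definition Uq_x : Uq := pres_gen Uq_proper 0.
Definition Uq_y : Uq := pres_gen Uq_proper 1.
Definition Uq_yV : Uq := pres_gen Uq_proper 2.
Definition Uq_z : Uq := pres_gen Uq_proper 3.

Local Notation x := Uq_x.
Local Notation y := Uq_y.
Local Notation yV := Uq_yV.
Local Notation z := Uq_z.

Definition nu_x : Uq := q *: (1 - y * z).
Definition nu_y : Uq := q *: (1 - z * x).
Definition nu_z : Uq := q *: (1 - x * y).

Lemma Uq_relsP : {in Uq_rels q x y yV z, forall r, r.1 = r.2}.
Proof.
rewrite -map_Uq_rels => r /mapP[p pr ->].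
exact: (pres_rel Uq_proper pr).
Qed.

Lemma Uq_relsE : [/\ y * yV = 1, yV * y = 1, qbracket q q x y = 1,
  qbracket q q y z = 1 & qbracket q q z x = 1].
Proof. exact/Uq_rels_and5/Uq_relsP. Qed.

Lemma nu_xE : nu_x = q^-1 *: (1 - z * y).
Proof. by apply: nuE; case: Uq_relsE. Qed.

Lemma nu_yE : nu_y = q^-1 *: (1 - x * z).
Proof. by apply: nuE; case: Uq_relsE. Qed.

Lemma nu_zE : nu_z = q^-1 *: (1 - y * x).
Proof. by apply: nuE; case: Uq_relsE. Qed.

Definition A_monomial (u : Uq) : Prop :=
  exists r s t : nat, ~~ odd (r + s + t) /\ u = x ^+ r * y ^+ s * z ^+ t.

Definition in_A : {pred Uq} := in_span A_monomial.

Lemma in_AE : in_A =i in_span (xyz_monomial x y z false).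
Proof.
have AE u : A_monomial u <-> xyz_monomial x y z false u.
  by split=> -[r [s [t [rst ->]]]]; exists r, s, t; split=> //;
    [apply: negbTE | apply: negbT].
by move=> u; apply/in_spanP/in_spanP => -[e eA ->]; exists e => // p /eA/AE.
Qed.

Fact in_A_subsemialg_closed : GRing.subsemialg_closed in_A.
Proof.
have [inA0 inAZ] := in_span_subsemimod_closed A_monomial.
have [_ _ /qbracket_eq1 yxE /qbracket_eq1 zyE xzE] := Uq_relsE.
have yx : exists a b, y * x = a *: (x * y) + b%:A by eexists; eexists; exact: yxE.
have zy : exists a b, z * y = a *: (y * z) + b%:A by eexists; eexists; exact: zyE.
have zx := qbracket_eq1V xzE.
split; [by rewrite in_AE xyz_span1 | exact: inA0 | exact: inAZ | move=> u v].
by rewrite !in_AE => uA vA; apply: (xyz_span_mul yx zx zy uA vA).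
Qed.

Record Aeven := InAeven { Aeven_val : Uq; _ : Aeven_val \in in_A }.

HB.instance Definition _ := [isSub for Aeven_val].
HB.instance Definition _ := [Choice of Aeven by <:].
HB.instance Definition _ :=
  GRing.SubChoice_isSubAlgebra.Build K Uq in_A Aeven in_A_subsemialg_closed.

End Uq.

(* Main.v *)
Require Import Defs.
From HB Require Import structures.
From mathcomp Require Import all_boot all_order all_algebra.
From mathcomp Require Import boolp functions ring.
From mathcomp.multinomials Require Import monalg.

Set Implicit Arguments.
Unset Strict Implicit.
Unset Printing Implicit Defensive.

Import GRing.Theory.
Local Open Scope ring_scope.

(** The relations of [A'] hold for the elements nu of U_q(sl2), so there is an
algebra morphism from [A'] to U_q(sl2) matching generators.  The theorem says
that it is injective with image [A].  Everything rests on the six quadratic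
monomials x^2, y^2, z^2, yx, yz, xz: all monomials of even degree are
polynomials in them, and all six are polynomials in the nu.  Indeed yx = 1 - q nu_z,
yz = 1 - q^-1 nu_x, xz = 1 - q nu_y, while the q-bracket of nu_y and nu_z is
1 - x^2, and so on cyclically ([sq_equitable]).

Image.  It contains the six quadratic monomials, hence all of [A]
([Aprime_to_Uq_onto_A]); conversely the nu lie in [A].

Injectivity.  Six elements of [A'] are defined by the same formulas in the nu.
With a q-bracket replaced by 1 - (square), the twelve cubic relations become
quadratic: each square q-commutes with two of the generators, and its products
with the third are explicit in the other two.  Multiplying two squares, one of
them written as a q-bracket, then gives the products of different squares
([sq_mul_next], [sq_mul_prev]).  These are the straightening rules for the six
elements ([nu_even_rels]).  By the rules, [A'] is spanned by even words
[even_word s r t] with s + r + t even ([even_word_span_mull]), and the word of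
index (s, r, t) is sent to y^s x^r z^t.  So it is enough that the monomials
y^s x^r z^t are linearly independent in U_q(sl2) ([Uq_coordinates]).

Independence.  U_q(sl2) acts on the functions on Z x N x N by the formulas for
left multiplication in the basis y^s x^r z^t ([Uq_lattice_module]), and the
monomial y^s x^r z^t maps the delta function at the origin to the one at
(s, r, t).  Writing y first turns y^-1 into a mere shift, while the usual order
x, y, z would need a recursion to move y^-1 past x^r.

The computations in noncommuting variables are left to a reflective procedure
that expands into words, rewrites by given relations and compares the
coefficients of each word in the base field. *)

(** * Normal forms of noncommutative polynomials *)

Section Reflection.
Variables (K : fieldType) (B : algType K).

Inductive ncexpr :=
| NCvar of nat | NC1
| NCadd of ncexpr & ncexpr | NCopp of ncexpr
| NCmul of ncexpr & ncexpr | NCexp of ncexpr & nat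
| NCscale of K & ncexpr.

(** A linear combination of words, as pairs (coefficient, word); letters are
indices in an environment. *)
Definition ncpoly := seq (K * seq nat).

Definition nc_scale (c : K) (p : ncpoly) : ncpoly :=
  map (fun t => (c * t.1, t.2)) p.

Definition nc_mul (p p' : ncpoly) : ncpoly :=
  foldr (fun t acc =>
    cat (map (fun t' => (t.1 * t'.1, cat t.2 t'.2)) p') acc) [::] p.

Fixpoint nc_exp (p : ncpoly) (n : nat) : ncpoly :=
  match n with
  | 0 => [:: (1, [::])]
  | S n' => nc_mul p (nc_exp p n')
  end.

Fixpoint nc_expand (e : ncexpr) : ncpoly :=
  match e with
  | NCvar i => [:: (1, [:: i])]
  | NC1 => [:: (1, [::])]
  | NCadd e1 e2 => cat (nc_expand e1) (nc_expand e2)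
  | NCopp e1 => nc_scale (-1) (nc_expand e1)
  | NCmul e1 e2 => nc_mul (nc_expand e1) (nc_expand e2)
  | NCexp e1 n => nc_exp (nc_expand e1) n
  | NCscale c e1 => nc_scale c (nc_expand e1)
  end.

Fixpoint same_word (v w : seq nat) : bool :=
  match v, w with
  | [::], [::] => true
  | i :: v', j :: w' => if Nat.eqb i j then same_word v' w' else false
  | _, _ => false
  end.

Fixpoint nc_insert (c : K) (w : seq nat) (p : ncpoly) : ncpoly :=
  match p with
  | [::] => [:: (c, w)]
  | t :: p' => if same_word w t.2 then (c + t.1, w) :: p'
               else t :: nc_insert c w p'
  end.

Definition nc_collect (p : ncpoly) : ncpoly :=
  foldr (fun t acc => nc_insert t.1 t.2 acc) [::] p.

Fixpoint strip_prefix (u w : seq nat) : option (seq nat) :=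
  match u, w with
  | [::], _ => Some w
  | i :: u', j :: w' => if Nat.eqb i j then strip_prefix u' w' else None
  | _, [::] => None
  end.

Fixpoint monomial_word (e : ncexpr) : option (seq nat) :=
  match e with
  | NCvar i => Some [:: i]
  | NCmul e1 e2 =>
    match monomial_word e1, monomial_word e2 with
    | Some v, Some w => Some (cat v w)
    | _, _ => None
    end
  | _ => None
  end.

(** Left-hand sides that are not products of variables are never applied. *)
Definition ncrules := seq (ncexpr * ncexpr).

Fixpoint rewrite_prefix (rs : ncrules) (w : seq nat) : option ncpoly :=
  match rs with
  | [::] => None
  | r :: rs' =>
    match monomial_word r.1 with
    | Some u =>
      match strip_prefix u w with
      | Some v => Some (nc_mul (nc_expand r.2) [:: (1, v)])
      | None => rewrite_prefix rs' w
      end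
    | None => rewrite_prefix rs' w
    end
  end.

Fixpoint rewrite_word (rs : ncrules) (w : seq nat) : option ncpoly :=
  match rewrite_prefix rs w with
  | Some p => Some p
  | None =>
    match w with
    | [::] => None
    | i :: w' =>
      match rewrite_word rs w' with
      | Some p => Some (map (fun t => (t.1, i :: t.2)) p)
      | None => None
      end
    end
  end.

Definition nc_step (rs : ncrules) (p : ncpoly) : ncpoly :=
  foldr (fun t acc =>
    match rewrite_word rs t.2 with
    | Some p' => cat (nc_scale t.1 p') acc
    | None => t :: acc
    end) [::] p.

(** The number of passes bounds the computation, since the rules are not known
to terminate; too small a bound only loses completeness. *)
Fixpoint nc_norm (rs : ncrules) (n : nat) (p : ncpoly) : ncpoly :=
  match n with
  | 0 => p
  | S n' => nc_norm rs n' (nc_collect (nc_step rs p))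
  end.

Fixpoint nc_null (p : ncpoly) : Prop :=
  match p with
  | [::] => True
  | t :: p' => t.1 = 0 /\ nc_null p'
  end.

Variable env : seq B.

Fixpoint nc_eval (e : ncexpr) : B :=
  match e with
  | NCvar i => nth 0 env i
  | NC1 => 1
  | NCadd e1 e2 => nc_eval e1 + nc_eval e2
  | NCopp e1 => - nc_eval e1
  | NCmul e1 e2 => nc_eval e1 * nc_eval e2
  | NCexp e1 n => nc_eval e1 ^+ n
  | NCscale c e1 => c *: nc_eval e1
  end.

Definition word_val (w : seq nat) : B :=
  foldr (fun i b => nth 0 env i * b) 1 w.

Definition poly_val (p : ncpoly) : B :=
  foldr (fun t b => t.1 *: word_val t.2 + b) 0 p.

Fixpoint nc_sound (rs : ncrules) : Prop :=
  match rs with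
  | [::] => True
  | r :: rs' => nc_eval r.1 = nc_eval r.2 /\ nc_sound rs'
  end.

Lemma word_val_cat v w : word_val (cat v w) = word_val v * word_val w.
Proof. by elim: v => [|i v IH] /=; rewrite ?mul1r // IH mulrA. Qed.

Lemma poly_val_cat p p' : poly_val (cat p p') = poly_val p + poly_val p'.
Proof. by elim: p => [|t p IH] /=; rewrite ?add0r // IH addrA. Qed.

Lemma poly_val_scale c p : poly_val (nc_scale c p) = c *: poly_val p.
Proof. by elim: p => [|t p IH] /=; rewrite ?scaler0 // IH scalerDr scalerA. Qed.

Lemma poly_val_mul p p' : poly_val (nc_mul p p') = poly_val p * poly_val p'.
Proof.
elim: p => [|[c w] p IH] /=; first by rewrite mul0r.
rewrite poly_val_cat {}IH mulrDl; congr (_ + _).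
elim: p' => [|[c' w'] p' IH] /=; first by rewrite mulr0.
by rewrite IH word_val_cat mulrDr -!scalerAl -scalerAr scalerA.
Qed.

Lemma poly_val_expand e : poly_val (nc_expand e) = nc_eval e.
Proof.
elim: e => [i||e1 IH1 e2 IH2|e1 IH1|e1 IH1 e2 IH2|e1 IH1 n|c e1 IH1] /=.
- by rewrite scale1r mulr1 addr0.
- by rewrite scale1r addr0.
- by rewrite poly_val_cat IH1 IH2.
- by rewrite poly_val_scale IH1 scaleN1r.
- by rewrite poly_val_mul IH1 IH2.
- elim: n => [|n IHn]; first by rewrite /= scale1r addr0.
  by rewrite /= poly_val_mul IH1 IHn exprS.
- by rewrite poly_val_scale IH1.
Qed.

Lemma same_wordP v w : same_word v w -> v = w.
Proof.
elim: v w => [|i v IH] [|j w] //=.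
by case: (boolP (Nat.eqb i j)) => // /PeanoNat.Nat.eqb_eq -> /IH ->.
Qed.

Lemma poly_val_insert c w p :
  poly_val (nc_insert c w p) = c *: word_val w + poly_val p.
Proof.
elim: p => //= t p IH; case: ifP => [/same_wordP <-|_] /=.
  by rewrite scalerDl addrA.
by rewrite IH addrCA.
Qed.

Lemma poly_val_collect p : poly_val (nc_collect p) = poly_val p.
Proof. by elim: p => //= t p IH; rewrite poly_val_insert IH. Qed.

Lemma strip_prefixP u w v : strip_prefix u w = Some v -> w = cat u v.
Proof.
elim: u w => [|i u IH] [|j w] //=; try by case.
by case: (boolP (Nat.eqb i j)) => // /PeanoNat.Nat.eqb_eq -> /IH ->.
Qed.

Lemma monomial_wordP e w : monomial_word e = Some w -> word_val w = nc_eval e.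
Proof.
elim: e w => //= [i|e1 IH1 e2 IH2] w; first by case=> <-; rewrite /= mulr1.
case: monomial_word IH1 => // v1 /(_ _ erefl) <-.
case: monomial_word IH2 => // v2 /(_ _ erefl) <- [<-].
exact: word_val_cat.
Qed.

Lemma rewrite_prefixP rs w p : nc_sound rs ->
  rewrite_prefix rs w = Some p -> poly_val p = word_val w.
Proof.
elim: rs => //= r rs IH [rE rsP].
case eu: monomial_word => [u|]; last exact: IH.
case e: strip_prefix => [v|]; last exact: IH.
move/strip_prefixP: e => -> [<-].
rewrite poly_val_mul poly_val_expand -rE word_val_cat (monomial_wordP eu).
by rewrite /= scale1r addr0.
Qed.

Lemma rewrite_wordP rs w p : nc_sound rs ->
  rewrite_word rs w = Some p -> poly_val p = word_val w.
Proof.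
move=> rsP; elim: w p => [|i w IH] p /=.
  by case e: rewrite_prefix => [p'|] // [<-]; apply: rewrite_prefixP e.
case e: rewrite_prefix => [p'|]; first by case=> <-; apply: rewrite_prefixP e.
case: rewrite_word IH => // p' /(_ _ erefl) <- [<-].
by elim: p' => [|t p' IH] /=; rewrite ?mulr0 // IH mulrDr -scalerAr.
Qed.

Lemma poly_val_norm rs n p :
  nc_sound rs -> poly_val (nc_norm rs n p) = poly_val p.
Proof.
move=> rsP; elim: n p => //= n IH p; rewrite IH poly_val_collect.
elim: p => //= t p IHp; case e: rewrite_word => [p'|] /=; last by rewrite IHp.
by rewrite poly_val_cat poly_val_scale IHp (rewrite_wordP rsP e).
Qed.

(** The coefficients stay symbolic, so that an identity of the algebra becomes
a list of identities in the field, one for each surviving word. *)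
Lemma nc_normP (rs : ncrules) (n : nat) (e1 e2 : ncexpr) : nc_sound rs ->
  nc_null (nc_norm rs n (nc_collect (nc_expand (NCadd e1 (NCopp e2))))) ->
  nc_eval e1 = nc_eval e2.
Proof.
move=> rsP nul; apply/eqP; rewrite -subr_eq0; apply/eqP.
rewrite -[LHS]/(nc_eval (NCadd e1 (NCopp e2))) -poly_val_expand.
rewrite -poly_val_collect -(poly_val_norm n _ rsP).
by elim: (nc_norm _ _ _) nul => //= t p IH [-> /IH ->]; rewrite scale0r addr0.
Qed.

End Reflection.

Ltac nc_index a env :=
  lazymatch env with
  | ?b :: ?env' =>
    match constr:(Set) with
    (* the inner match runs the test while a term is being computed *)
    | _ => let _ := match constr:(Set) with _ => constr_eq a b end in
           constr:(0%N)
    | _ => let i := nc_index a env' in constr:(S i)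
    end
  end.

Ltac nc_reify K env u :=
  lazymatch u with
  | 1 => constr:(NC1 K)
  | ?a + ?b => let e := nc_reify K env a in let e' := nc_reify K env b in
      constr:(NCadd e e')
  | - ?a => let e := nc_reify K env a in constr:(NCopp e)
  | ?a * ?b => let e := nc_reify K env a in let e' := nc_reify K env b in
      constr:(NCmul e e')
  | ?a ^+ ?n => let e := nc_reify K env a in constr:(NCexp e n)
  | ?c *: ?a => let e := nc_reify K env a in constr:(NCscale c e)
  | _ => let i := nc_index u env in constr:(NCvar K i)
  end.

(** The rewriting rules are given as proofs of equations, in a left-nested tuple
that starts with [tt]. *)
Ltac nc_rules K env Hs :=
  lazymatch Hs with
  | tt => constr:(@nil (ncexpr K * ncexpr K))
  | (?Hs', ?H) =>
    let rs := nc_rules K env Hs' in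
    lazymatch type of H with
    | ?a = ?b => let e := nc_reify K env a in let e' := nc_reify K env b in
       constr:((e, e') :: rs)
    end
  end.

Ltac nc_sound_proof Hs :=
  lazymatch Hs with
  | tt => exact I
  | (?Hs', ?H) => split; [exact H | nc_sound_proof Hs']
  end.

Ltac nc_reduce K B n env Hs :=
  lazymatch goal with
  | |- ?a = ?b =>
    let rs := nc_rules K env Hs in
    let e1 := nc_reify K env a in
    let e2 := nc_reify K env b in
    refine (@nc_normP K B env rs n e1 e2 _ _);
    [ nc_sound_proof Hs
    (* only the procedure is unfolded: the field operations stay folded *)
    | cbv [nc_null nc_norm nc_step rewrite_word rewrite_prefix monomial_word
           strip_prefix nc_collect nc_insert same_word nc_expand nc_exp nc_mul
           nc_scale map foldr cat fst snd Nat.eqb] ]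
  end.

(** Proves an equation of [B] in the variables [env], by [n] passes of rewriting
with [Hs]; the nonzero denominators must be among the hypotheses. *)
Ltac nc_ring K B n env Hs :=
  nc_reduce K B n env Hs;
  repeat (match goal with |- _ /\ _ => split | |- True => exact I end);
  field; repeat (apply/andP; split); first [assumption | exact isT].

(** * Consequences of the defining relations *)

Definition nu_rels (K : fieldType) (q : K) (B : algType K) (a b c : B) : Prop :=
  {in Aprime_rels q a b c, forall r, r.1 = r.2}.

(** For b, c equal to nu_y, nu_z this is x^2, and cyclically. *)
Definition sq (K : fieldType) (q : K) (B : algType K) (b c : B) : B :=
  1 - qbracket q q b c.

Section Relations.
Variables (K : fieldType) (q : K).
(* the form in which [field] asks for q^2 != 1 *)
Hypotheses (q0 : q != 0) (qq1 : q * q - 1 != 0).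
Variable B : algType K.
Local Ltac nc n env Hs := nc_ring K B n env Hs.

(** The twelve relations form four families permuted cyclically, so that each
consequence below is needed for one position of the variables only. *)
Lemma nu_rels_rot (a b c : B) : nu_rels q a b c -> nu_rels q b c a.
Proof.
move=> H r Hr; apply: H; move: Hr; rewrite /Aprime_rels !inE.
by do 11?[case/orP => [->|]; rewrite ?orbT //]; move=> ->; rewrite ?orbT.
Qed.

Section Squares.
Variables a b c : B.
Hypothesis abc : nu_rels q a b c.
Local Notation X := (sq q b c).

Let in_rels u v : (u, v) \in Aprime_rels q a b c -> u = v.
Proof. exact: abc. Qed.

Lemma sq_bracket : b * c = q ^- 2 *: (c * b) + (q^-1 * (q - q^-1)) *: (1 - X).
Proof. by rewrite /sq /qbracket; nc 0%N [:: b; c] tt. Qed.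

(** A cubic relation in b and c is q^2 b Q - q^-2 Q b = (q^2 - q^-2) b up to a
scalar, where Q is the q-bracket of b and c; the right-hand side disappears
when Q is replaced by 1 - X.  The next lemma is the mirror image, with c. *)
Lemma sq_mulr_fst : X * b = q ^+ 4 *: (b * X).
Proof.
have E : q ^+ 3 *: (b ^+ 2 * c) - (q + q^-1) *: (b * c * b)
    + q ^- 3 *: (c * b ^+ 2) = ((q ^+ 2 - q ^- 2) * (q - q^-1)) *: b.
  by apply: in_rels; rewrite !inE eqxx !orbT.
have {}E : b * b * c = q ^- 3 *: ((q + q^-1) *: (b * c * b)
    - q ^- 3 *: (c * b * b) + ((q ^+ 2 - q ^- 2) * (q - q^-1)) *: b).
  by rewrite -E; nc 0%N [:: b; c] tt.
by rewrite /sq /qbracket; nc 3%N [:: b; c] (tt, E).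
Qed.

Lemma sq_mulr_snd : X * c = q ^- 4 *: (c * X).
Proof.
have E : q ^- 3 *: (c ^+ 2 * b) - (q + q^-1) *: (c * b * c)
    + q ^+ 3 *: (b * c ^+ 2) = ((q ^+ 2 - q ^- 2) * (q - q^-1)) *: c.
  by apply: in_rels; rewrite !inE eqxx !orbT.
have {}E : c * c * b = q ^+ 3 *: ((q + q^-1) *: (c * b * c)
    - q ^+ 3 *: (b * c * c) + ((q ^+ 2 - q ^- 2) * (q - q^-1)) *: c).
  by rewrite -E; nc 0%N [:: b; c] tt.
by rewrite /sq /qbracket; nc 3%N [:: b; c] (tt, E).
Qed.

(** In the relations that involve three generators the linear term a cancels
when the q-bracket is replaced by 1 - X. *)
Lemma sq_mull :
  a * X = q ^- 2 *: b + q ^+ 2 *: c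
    - (q - q^-1)^-1 *: (q ^+ 2 *: (b * c) - q ^- 2 *: (c * b)).
Proof.
have E : a * qbracket q q b c
    = a - q ^- 2 *: b - q ^+ 2 *: c + qbracket q (q ^+ 2) b c.
  by apply: in_rels; rewrite !inE eqxx !orbT.
rewrite -[X in - X]/(qbracket q (q ^+ 2) b c) /sq.
move: E; set u := qbracket _ _ _ _; set v := qbracket _ _ _ _ => E.
by nc 1%N [:: a; b; c; u; v] (tt, E).
Qed.

Lemma sq_mulr :
  X * a = q ^+ 2 *: b + q ^- 2 *: c
    - (q - q^-1)^-1 *: (q ^+ 2 *: (b * c) - q ^- 2 *: (c * b)).
Proof.
have E : qbracket q q b c * a
    = a - q ^+ 2 *: b - q ^- 2 *: c + qbracket q (q ^+ 2) b c.
  by apply: in_rels; rewrite !inE eqxx !orbT.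
rewrite -[X in - X]/(qbracket q (q ^+ 2) b c) /sq.
move: E; set u := qbracket _ _ _ _; set v := qbracket _ _ _ _ => E.
by nc 1%N [:: a; b; c; u; v] (tt, E).
Qed.

End Squares.

(** In U_q(sl2) this reads x^2 y^2 = (xy)(xy - 1 + q^2) / q^2.  Here it follows
by expanding the second square as a q-bracket of c and a: the first square
q-commutes with c and its product with a is known. *)
Lemma sq_mul_next (a b c : B) : nu_rels q a b c ->
  sq q b c * sq q c a = (1 - q^-1 *: c) * (1 - q ^- 3 *: c).
Proof.
move=> abc; set X := sq q b c.
have E1 : X * c = _ := sq_mulr_snd abc.
have E2 : X * a = _ := sq_mulr abc.
have E3 : b * c = _ := sq_bracket b c.
rewrite -/X in E1 E2 E3.
rewrite /(sq q c a) /qbracket.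
by nc 6%N [:: a; b; c; X] (tt, E1, E2, E3).
Qed.

(** Similarly y^2 x^2 = q^2 (yx)(yx - 1 + q^-2); now the second factor is
expanded, as a q-bracket of b and c. *)
Lemma sq_mul_prev (a b c : B) : nu_rels q a b c ->
  sq q c a * sq q b c = (1 - q *: c) * (1 - q ^+ 3 *: c).
Proof.
move=> abc; set Y := sq q c a.
have E1 : Y * c = _ := sq_mulr_fst (nu_rels_rot abc).
have E2 : Y * b = _ := sq_mulr (nu_rels_rot abc).
have E3 : c * a = _ := sq_bracket c a.
rewrite -/Y in E1 E2 E3.
rewrite /(sq q b c) /qbracket.
by nc 6%N [:: a; b; c; Y] (tt, E1, E2, E3).
Qed.

End Relations.

(** * Even words and their span *)

Section EvenWord.
Variables (R : pzRingType) (x2 y2 z2 yx yz xz : R).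

(** For r and t of the same parity this is x^r z^t when the parameters are the
quadratic monomials that their names suggest. *)
Definition even_word_xz (r t : nat) : R :=
  x2 ^+ r./2 * (xz ^+ odd r * z2 ^+ t./2).

(** For s + r + t even this stands for y^s x^r z^t: the last letter of an odd
power of y is paired with the first letter of x^r, or of z^t if r = 0. *)
Definition even_word (s r t : nat) : R :=
  y2 ^+ s./2 *
  (if odd s then if r is r'.+1 then yx * even_word_xz r' t
                 else yz * even_word_xz 0 t.-1
   else even_word_xz r t).

Definition is_even_word (u : R) : Prop :=
  exists s r t, ~~ odd (s + r + t) /\ u = even_word s r t.

End EvenWord.

Section EvenRelations.
Variables (K : fieldType) (q : K) (B : algType K).

(** The rules that bring the product of two quadratic monomials to the order
y, x, z, for a first factor yx, yz or xz: these three elements and 1 span the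
same space as 1 and the generators nu, so that left multiplications by them
are the only ones to be studied. *)
Record even_rels (x2 y2 z2 yx yz xz : B) : Prop := EvenRels {
  yx_y2 : yx * y2 = q ^- 4 *: (y2 * yx) + (1 - q ^- 4) *: y2;
  yx_yx : yx * yx = q ^- 2 *: (y2 * x2) + (1 - q ^- 2) *: yx;
  yx_yz : yx * yz = q ^- 2 *: (y2 * xz) + (1 - q ^- 2) *: yz;
  yz_y2 : yz * y2 = q ^+ 4 *: (y2 * yz) + (1 - q ^+ 4) *: y2;
  yz_yx : yz * yx = y2 * xz + (q ^+ 2 - 1) *: y2 + (1 - q ^+ 2) *: yx;
  yz_yz : yz * yz = q ^+ 2 *: (y2 * z2) + (1 - q ^+ 2) *: yz;
  yz_x2 : yz * x2 = q ^- 4 *: (yx * xz) + (1 - q ^- 4) *: yx;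
  yz_xz : yz * xz = q ^- 2 *: (yx * z2) + (1 - q ^- 2) *: yz;
  xz_y2 : xz * y2 = y2 * xz + (q ^+ 4 - 1) *: yz
      + ((1 - q ^+ 4) * q ^- 2) *: yx
      + ((1 - q ^+ 4) * (1 - q ^- 2)) *: 1;
  xz_yx : xz * yx = q ^- 2 *: (yx * xz) + (1 - q ^- 2) *: yx
      + (1 - q ^- 2) *: xz + (1 - q ^+ 2) *: x2
      + (q ^+ 2 * (1 - q ^- 2) ^+ 2) *: 1;
  xz_yz : xz * yz = yx * z2 + (q ^+ 2 - 1) *: z2 + (1 - q ^+ 2) *: xz;
  xz_x2 : xz * x2 = q ^- 4 *: (x2 * xz) + (1 - q ^- 4) *: x2;
  xz_xz : xz * xz = q ^- 2 *: (x2 * z2) + (1 - q ^- 2) *: xz }.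

End EvenRelations.

Section EvenSpan.
Variables (K : fieldType) (q : K) (B : algType K) (x2 y2 z2 yx yz xz : B).
Hypothesis rels : even_rels q x2 y2 z2 yx yz xz.

Let xz_word (u : B) : Prop :=
  exists j k, u = x2 ^+ j * z2 ^+ k \/ u = x2 ^+ j * (xz * z2 ^+ k).
Let xzW := in_span xz_word.
Let evenW := in_span (is_even_word x2 y2 z2 yx yz xz).

(** Straightens the first two factors of a product by [E] and splits the
resulting sum. *)
Ltac span_rel E :=
  rewrite mulrA E ?mulrDl -?scalerAl -?mulrA ?mul1r;
  repeat (apply: in_spanD || apply: in_spanZ).

Let xzW_z k : z2 ^+ k \in xzW.
Proof. by apply: mem_in_span; exists 0%N, k; left; rewrite mul1r. Qed.

Let xzW_xz_z k : xz * z2 ^+ k \in xzW.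
Proof. by apply: mem_in_span; exists 0%N, k; right; rewrite mul1r. Qed.

Let xzW_x2 : {in xzW, forall u, x2 * u \in xzW}.
Proof.
apply: (in_span_ind (mull_linear x2)); first exact: in_span_subsemimod_closed.
move=> u [j [k uE]]; apply: mem_in_span; exists j.+1, k.
by case: uE => ->; rewrite mulrA -exprS; [left | right].
Qed.

(** Left multiplication by g is controlled by its effect on the words without
x^2, provided that g can be moved past x^2. *)
Let xzW_ind (g : B) :
    (forall k, g * z2 ^+ k \in xzW) -> (forall k, g * (xz * z2 ^+ k) \in xzW) ->
    (forall u, u \in xzW -> g * u \in xzW -> g * (x2 * u) \in xzW) ->
  {in xzW, forall u, g * u \in xzW}.
Proof.
move=> g0 g1 gx; apply: (in_span_ind (mull_linear g)).
  exact: in_span_subsemimod_closed.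
have gX j v : v \in xzW -> g * v \in xzW -> g * (x2 ^+ j * v) \in xzW.
  move=> vD gvD; suff: x2 ^+ j * v \in xzW /\ g * (x2 ^+ j * v) \in xzW by case.
  elim: j => [|j [IH1 IH2]]; first by rewrite mul1r.
  by rewrite exprS -mulrA; split; [apply: xzW_x2 | apply: gx].
by move=> _ [j [k [] ->]]; apply: gX.
Qed.

Let xzW_xz : {in xzW, forall u, xz * u \in xzW}.
Proof.
apply: xzW_ind => [//|k|u uD xzuD].
  by span_rel (xz_xz rels); rewrite -?exprS ?xzW_x2.
by span_rel (xz_x2 rels); do ?apply: xzW_x2.
Qed.

Let evenW_y2 : {in evenW, forall u, y2 * u \in evenW}.
Proof.
apply: (in_span_ind (mull_linear y2)); first exact: in_span_subsemimod_closed.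
move=> _ [s [r [t [srt ->]]]]; apply: mem_in_span; exists s.+2, r, t.
by rewrite !addSn /even_word /= !negbK mulrA -exprS.
Qed.

Let evenW_xzW : {in xzW, forall u, u \in evenW}.
Proof.
have id_linear : linear (fun u : B => u) by [].
apply: (in_span_ind id_linear); first exact: in_span_subsemimod_closed.
move=> _ [j [k [] ->]]; apply: mem_in_span.
  exists 0%N, j.*2, k.*2; rewrite !oddD !odd_double; split=> //.
  by rewrite /even_word /even_word_xz /= odd_double !doubleK !mul1r.
exists 0%N, j.*2.+1, k.*2.+1; rewrite !oddD /= !odd_double.
split=> //.
by rewrite /even_word /even_word_xz /= odd_double !uphalf_double mul1r.
Qed.

Let evenW_yx_xzW : {in xzW, forall u, yx * u \in evenW}.
Proof.
apply: (in_span_ind (mull_linear yx)); first exact: in_span_subsemimod_closed.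
move=> _ [j [k [] ->]]; apply: mem_in_span.
  exists 1%N, j.*2.+1, k.*2; rewrite !oddD /= !odd_double.
  by split=> //; rewrite /even_word /even_word_xz /= odd_double !doubleK !mul1r.
exists 1%N, j.*2.+2, k.*2.+1; rewrite !oddD /= !odd_double.
split=> //.
by rewrite /even_word /even_word_xz /= odd_double !uphalf_double mul1r.
Qed.

Let evenW_yz k : yz * z2 ^+ k \in evenW.
Proof.
apply: mem_in_span; exists 1%N, 0%N, k.*2.+1.
rewrite !oddD /= odd_double; split=> //.
by rewrite /even_word /even_word_xz /= doubleK !mul1r.
Qed.

(** The words without y^2 are of three kinds: no y, a leading yx, or a leading
yz followed by a power of z^2. *)
Let evenW_ind (g : B) :
    {in xzW, forall u, g * u \in evenW} ->
    {in xzW, forall u, g * (yx * u) \in evenW} ->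
    (forall k, g * (yz * z2 ^+ k) \in evenW) ->
    (forall u, u \in evenW -> g * u \in evenW -> g * (y2 * u) \in evenW) ->
  {in evenW, forall u, g * u \in evenW}.
Proof.
move=> g0 gyx gyz gy; apply: (in_span_ind (mull_linear g)).
  exact: in_span_subsemimod_closed.
have gY i v : v \in evenW -> g * v \in evenW -> g * (y2 ^+ i * v) \in evenW.
  move=> vS gvS.
  suff: y2 ^+ i * v \in evenW /\ g * (y2 ^+ i * v) \in evenW by case.
  elim: i => [|i [IH1 IH2]]; first by rewrite mul1r.
  by rewrite exprS -mulrA; split; [apply: evenW_y2 | apply: gy].
have xz_in_xzW r t : even_word_xz x2 z2 xz r t \in xzW.
  rewrite /even_word_xz; elim: r./2 => [|j IH]; last first.
    by rewrite exprS -mulrA xzW_x2.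
  by rewrite mul1r; case: odd; rewrite ?mul1r.
move=> _ [s [r [t [_ ->]]]]; apply: gY.
  case: odd; last exact: evenW_xzW.
  by case: r => [|r]; [rewrite /even_word_xz !mul1r | apply: evenW_yx_xzW].
case: odd; last exact: g0.
by case: r => [|r]; [rewrite /even_word_xz !mul1r | apply: gyx].
Qed.

Lemma even_span_yx : {in evenW, forall u, yx * u \in evenW}.
Proof.
apply: evenW_ind => [//|u uD|k|u uS yxuS].
- by span_rel (yx_yx rels); rewrite ?evenW_y2 ?evenW_yx_xzW ?evenW_xzW ?xzW_x2.
- by span_rel (yx_yz rels); rewrite ?evenW_y2 ?evenW_yz ?evenW_xzW ?xzW_xz_z.
by span_rel (yx_y2 rels); rewrite ?evenW_y2.
Qed.

Let evenW_yz_xzW : {in xzW, forall u, yz * u \in evenW}.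
Proof.
apply: (in_span_ind (mull_linear yz)); first exact: in_span_subsemimod_closed.
move=> _ [[|j] [k [] ->]]; rewrite ?mul1r //.
- by span_rel (yz_xz rels); rewrite -?exprS ?evenW_yz ?evenW_yx_xzW ?xzW_z.
- rewrite exprS -mulrA; span_rel (yz_x2 rels);
    by rewrite evenW_yx_xzW ?xzW_xz //; apply: mem_in_span; exists j, k; left.
- rewrite exprS -mulrA; span_rel (yz_x2 rels);
    by rewrite evenW_yx_xzW ?xzW_xz //; apply: mem_in_span; exists j, k; right.
Qed.

Lemma even_span_yz : {in evenW, forall u, yz * u \in evenW}.
Proof.
apply: evenW_ind => [//|u uD|k|u uS yzuS].
- by span_rel (yz_yx rels); rewrite ?evenW_y2 ?evenW_yx_xzW ?evenW_xzW ?xzW_xz.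
- span_rel (yz_yz rels);
    by rewrite -?exprS ?evenW_yz ?evenW_y2 ?evenW_xzW ?xzW_z.
by span_rel (yz_y2 rels); rewrite ?evenW_y2.
Qed.

(** Straightening xz y^2 produces the factors yx and yz again, so that the
closure under these must come first. *)
Lemma even_span_xz : {in evenW, forall u, xz * u \in evenW}.
Proof.
apply: evenW_ind => [u uD|u uD|k|u uS xzuS]; first by rewrite evenW_xzW ?xzW_xz.
- by span_rel (xz_yx rels); rewrite ?evenW_yx_xzW ?evenW_xzW ?xzW_xz ?xzW_x2.
- span_rel (xz_yz rels);
    by rewrite -?exprS ?evenW_yx_xzW ?evenW_xzW ?xzW_xz_z ?xzW_z.
by span_rel (xz_y2 rels); rewrite ?evenW_y2 ?even_span_yz ?even_span_yx.
Qed.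

Lemma is_even_word1 : is_even_word x2 y2 z2 yx yz xz 1.
Proof. by exists 0%N, 0%N, 0%N; rewrite /even_word /even_word_xz !mul1r. Qed.

End EvenSpan.

Section Quadratic.
Variables (K : fieldType) (q : K).
Hypotheses (q0 : q != 0) (qq1 : q * q - 1 != 0).
Variables (B : algType K) (a b c : B).
Hypothesis abc : nu_rels q a b c.

Let x2 := sq q b c.
Let y2 := sq q c a.
Let z2 := sq q a b.
Let yx := 1 - q *: c.
Let yz := 1 - q^-1 *: a.
Let xz := 1 - q *: b.

Let bca : nu_rels q b c a := nu_rels_rot abc.
Let cab : nu_rels q c a b := nu_rels_rot bca.

(* Used as rewriting rules, from left to right: the left-hand sides are words of
length two in the generators and the squares. *)
Let E0 : b * c = _ *: (c * b) + _ *: (1 - x2) :=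
  sq_bracket q0 qq1 b c.
Let E1 : x2 * b = _ *: (b * x2) :=
  sq_mulr_fst q0 qq1 abc.
Let E2 : a * x2 = _ *: b + _ *: c - _ *: (_ *: (b * c) - _ *: (c * b)) :=
  sq_mull q0 abc.
Let E3 : y2 * x2 = (1 - _ *: c) * (1 - _ *: c) :=
  sq_mul_prev q0 qq1 abc.
Let E4 : c * a = _ *: (a * c) + _ *: (1 - y2) :=
  sq_bracket q0 qq1 c a.
Let E5 : y2 * c = _ *: (c * y2) :=
  sq_mulr_fst q0 qq1 bca.
Let E6 : y2 * a = _ *: (a * y2) :=
  sq_mulr_snd q0 qq1 bca.
Let E7 : b * y2 = _ *: c + _ *: a - _ *: (_ *: (c * a) - _ *: (a * c)) :=
  sq_mull q0 bca.
Let E8 : y2 * b = _ *: c + _ *: a - _ *: (_ *: (c * a) - _ *: (a * c)) :=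
  sq_mulr q0 bca.
Let E9 : y2 * z2 = (1 - _ *: a) * (1 - _ *: a) :=
  sq_mul_next q0 qq1 bca.
Let E10 : a * b = _ *: (b * a) + _ *: (1 - z2) :=
  sq_bracket q0 qq1 a b.
Let E11 : c * z2 = _ *: a + _ *: b - _ *: (_ *: (a * b) - _ *: (b * a)) :=
  sq_mull q0 cab.
Let E12 : x2 * z2 = (1 - _ *: b) * (1 - _ *: b) :=
  sq_mul_prev q0 qq1 cab.

Ltac straighten :=
  rewrite /yx /yz /xz;
  nc_ring K B 5%N [:: a; b; c; x2; y2; z2]
    (tt, E0, E1, E2, E3, E4, E5, E6, E7, E8, E9, E10, E11, E12).

Lemma nu_even_rels : even_rels q x2 y2 z2 yx yz xz.
Proof. by split; straighten. Qed.

Local Notation evenW := (in_span (is_even_word x2 y2 z2 yx yz xz)).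

Let evenW_nu (k : K) (g h : B) : k != 0 -> h = 1 - k *: g ->
  {in evenW, forall u, h * u \in evenW} ->
  {in evenW, forall u, g * u \in evenW}.
Proof.
move=> k0 hE hS u uS.
(* solve h = 1 - k g for g *)
have -> : g = (- k^-1) *: h + k^-1 *: 1.
  rewrite hE scalerBr scalerA mulNr mulVf // !scaleNr scale1r opprK addrC.
  by rewrite addrA subrr add0r.
rewrite mulrDl -!scalerAl mul1r.
by apply: in_spanD; apply: in_spanZ; rewrite ?hS.
Qed.

(** As the span of the even words also contains 1, it contains the subalgebra
generated by a, b and c. *)
Lemma even_word_span_mull g :
  g \in [:: a; b; c] -> {in evenW, forall u, g * u \in evenW}.
Proof.
rewrite !inE => /or3P[] /eqP->.
- apply: (evenW_nu (k := q^-1) _ erefl (even_span_yz nu_even_rels)).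
  by rewrite invr_eq0.
- exact: (evenW_nu q0 erefl (even_span_xz nu_even_rels)).
- exact: (evenW_nu q0 erefl (even_span_yx nu_even_rels)).
Qed.

End Quadratic.

(** * Equitable triples satisfy the relations *)

Section Equitable.
Variables (K : fieldType) (q : K).
Hypotheses (q0 : q != 0) (qq1 : q * q - 1 != 0).
Variables (B : algType K).

Lemma qbracket_swap (u v : B) : qbracket q q u v = 1 ->
  (u * v = q ^- 2 *: (v * u) + (1 - q ^- 2) *: 1) *
  (v * u = q ^+ 2 *: (u * v) + (1 - q ^+ 2) *: 1).
Proof.
by rewrite /qbracket => E; split; rewrite -E; nc_ring K B 0%N [:: u; v] tt.
Qed.

Lemma nu_mulE (u v : B) : 1 - q^-1 *: (q *: (1 - u * v)) = u * v.
Proof. by nc_ring K B 0%N [:: u; v] tt. Qed.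

Lemma nu_mulCE (u v : B) :
  qbracket q q u v = 1 -> 1 - q *: (q *: (1 - u * v)) = v * u.
Proof. by move/qbracket_swap=> [_ ->]; nc_ring K B 0%N [:: u; v] tt. Qed.

Section EquitableTriple.
Variables x y z : B.
Hypotheses (xy1 : qbracket q q x y = 1) (yz1 : qbracket q q y z = 1)
           (zx1 : qbracket q q z x = 1).

Let xyE : x * y = _ *: (y * x) + _ *: 1 := (qbracket_swap xy1).1.
Let zyE : z * y = _ *: (y * z) + _ *: 1 := (qbracket_swap yz1).2.
Let zxE : z * x = _ *: (x * z) + _ *: 1 := (qbracket_swap zx1).1.

(** Brings words to the order y, x, z. *)
Ltac nc_xyz :=
  rewrite /qbracket; nc_ring K B 10%N [:: x; y; z] (tt, xyE, zyE, zxE).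

Lemma nu_rels_equitable :
  nu_rels q (q *: (1 - y * z)) (q *: (1 - z * x)) (q *: (1 - x * y)).
Proof.
move=> r; rewrite !inE.
do 11?[case/orP => [/eqP-> /=|]; [nc_xyz |]].
by move/eqP=> -> /=; nc_xyz.
Qed.

Lemma sq_equitable : sq q (q *: (1 - z * x)) (q *: (1 - x * y)) = x ^+ 2.
Proof. by rewrite /sq; nc_xyz. Qed.

End EquitableTriple.
End Equitable.

(** * Presented algebras: universal property and induction *)

Section Lift.
Variables (K : fieldType) (n : nat) (rels : seq (free_alg K n * free_alg K n)).
Variables (nz : ~ rel_ideal rels 1) (B : algType K) (b : 'I_n -> B).
Hypothesis brel : {in rels, forall r, free_eval b r.1 = free_eval b r.2}.

(** The proof that b satisfies the relations is an argument so that the morphism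
structures, which depend on it, can be inferred from the function. *)
Definition pres_lift
    (brel : {in rels, forall r, free_eval b r.1 = free_eval b r.2})
    (u : pres_alg nz) : B :=
  free_eval b (repr u).

Lemma pres_liftE a : pres_lift brel (pres_pi nz a) = free_eval b a.
Proof.
apply/eqP; rewrite -subr_eq0 -rmorphB; apply/eqP.
by apply: (free_eval_rel_ideal brel); apply/in_rel_idealP/repr_pi.
Qed.

Lemma pres_piP (u : pres_alg nz) : exists a, u = pres_pi nz a.
Proof. by exists (repr u); rewrite /pres_pi reprK. Qed.

Fact pres_lift_zmod_morphism : zmod_morphism (pres_lift brel).
Proof.
move=> u v; have [[a ->] [c ->]] := (pres_piP u, pres_piP v).
by rewrite -rmorphB /= !pres_liftE rmorphB.
Qed.

HB.instance Definition _ :=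
  GRing.isZmodMorphism.Build (pres_alg nz) B (pres_lift brel)
    pres_lift_zmod_morphism.

Fact pres_lift_monoid_morphism : monoid_morphism (pres_lift brel).
Proof.
split=> [|u v]; first by rewrite -(rmorph1 (pres_pi nz)) pres_liftE rmorph1.
have [[a ->] [c ->]] := (pres_piP u, pres_piP v).
by rewrite -rmorphM /= !pres_liftE rmorphM.
Qed.

HB.instance Definition _ :=
  GRing.isMonoidMorphism.Build (pres_alg nz) B (pres_lift brel)
    pres_lift_monoid_morphism.

Fact pres_lift_scalable : scalable (pres_lift brel).
Proof.
move=> k u; have [a ->] := pres_piP u.
by rewrite -linearZ /= !pres_liftE linearZ.
Qed.

HB.instance Definition _ :=
  GRing.isScalable.Build K (pres_alg nz) B *:%R (pres_lift brel)
    pres_lift_scalable.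

Lemma pres_alg_lift :
  exists f : {lrmorphism pres_alg nz -> B}, forall i, f (pres_gen nz i) = b i.
Proof. by exists (pres_lift brel) => i; rewrite /= pres_liftE free_evalE. Qed.

Lemma pres_alg_ind (P : {pred pres_alg nz}) :
    GRing.subsemimod_closed P -> 1 \in P ->
    (forall i u, u \in P -> pres_gen nz i * u \in P) ->
  forall u, u \in P.
Proof.
move=> [[P0 PD] PZ] P1 PM u; have [a ->] := pres_piP u.
rewrite [a]monalgE raddf_sum /=.
elim/big_rec: _ => // w v _ vP; apply: PD => //.
have -> : << a@_w *g w >> = a@_w *: << w >> :> free_alg K n.
  by apply/malgP => v'; rewrite mcoeffZ !mcoeffU mulr_natr.
rewrite linearZ /=; apply: PZ; rewrite -[w]fmK; elim: (w : seq _) => [|i s IH].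
  by rewrite -fmoneE (rmorph1 (pres_pi nz)).
have -> : << FMonom (i :: s) >> = free_gen K i * << FMonom s >>.
  rewrite malgM_def fgmulUU mulr1; congr << _ >>.
  by rewrite -[RHS]/(fmmul _ _) fmmulE fmuE.
by rewrite rmorphM; apply: PM.
Qed.
End Lift.

(** * The algebra of linear operators *)

Section EndAlgebra.
Variables (K : fieldType) (V : lmodType K).

Definition is_linear_op : {pred (V -> V)} :=
  [pred f : V -> V | `[< linear f >]].

Fact is_linear_op_submod : GRing.submod_closed is_linear_op.
Proof.
split=> [|k f g /asboolP fL /asboolP gL]; apply/asboolP => l u v.
  by rewrite /= [RHS]addr0 [RHS]scaler0.
rewrite -![(k *: f + g) _]/(k *: f _ + g _) fL gL !scalerDr !scalerA addrACA.
by rewrite [k * l]mulrC.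
Qed.

(** The nonzero vector witnesses that the identity is not 0, as the structure of
algebra demands. *)
Record linear_op (v : V) (v_neq0 : v != 0) :=
  LinearOp { linear_op_fun : V -> V; _ : linear_op_fun \in is_linear_op }.

Variables (v0 : V) (v0_neq0 : v0 != 0).
Local Notation E := (linear_op v0_neq0).

HB.instance Definition _ := [isSub for @linear_op_fun v0 v0_neq0].
HB.instance Definition _ := [Choice of E by <:].
HB.instance Definition _ :=
  GRing.SubChoice_isSubLmodule.Build K (V -> V) is_linear_op E
    is_linear_op_submod.

Lemma linear_opP (f : E) : linear (val f).
Proof. by apply/asboolP; apply: (valP f). Qed.

Definition mk_op (f : V -> V) (fL : linear f) : E :=
  LinearOp v0_neq0 (introT (asboolP _) fL).

Fact id_linear : linear (fun u : V => u). Proof. by []. Qed.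

Fact comp_linear (f g : E) : linear (fun u : V => val f (val g u)).
Proof. by move=> k u v; rewrite !linear_opP. Qed.

Definition op_one : E := mk_op id_linear.
Definition op_mul (f g : E) : E := mk_op (comp_linear f g).

Lemma op_eqP (f g : E) : val f =1 val g -> f = g.
Proof. by move=> fg; apply: val_inj; apply: funext. Qed.

Fact op_mulA : associative op_mul. Proof. by move=> f g h; apply: op_eqP. Qed.
Fact op_mul1 : left_id op_one op_mul. Proof. by move=> f; apply: op_eqP. Qed.
Fact op_mulr1 : right_id op_one op_mul. Proof. by move=> f; apply: op_eqP. Qed.
Fact op_mulDl : left_distributive op_mul +%R.
Proof. by move=> f g h; apply: op_eqP. Qed.
Fact op_mulDr : right_distributive op_mul +%R.
Proof.
move=> f g h; apply: op_eqP => u /=.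
by have := linear_opP f 1 (val g u) (val h u); rewrite !scale1r.
Qed.
Fact op_one_neq0 : op_one != 0.
Proof.
apply: contra_neq v0_neq0 => e.
by have := congr1 (fun f : E => val f v0) e.
Qed.

HB.instance Definition _ := GRing.Zmodule_isNzRing.Build E
  op_mulA op_mul1 op_mulr1 op_mulDl op_mulDr op_one_neq0.

Fact op_scalerAl k (f g : E) : k *: (f * g) = (k *: f) * g.
Proof. exact: op_eqP. Qed.

HB.instance Definition _ := GRing.Lmodule_isLalgebra.Build K E op_scalerAl.

Fact op_scalerAr k (f g : E) : k *: (f * g) = f * (k *: g).
Proof.
apply: op_eqP => u.
have f0 : val f 0 = 0.
  by have := linear_opP f (-1) 0 0; rewrite !scaleN1r !addNr.
by have := linear_opP f k (val g u) 0; rewrite f0 !addr0.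
Qed.

HB.instance Definition _ := GRing.Lalgebra_isAlgebra.Build K E op_scalerAr.

Lemma op_oneE u : val (1 : E) u = u. Proof. by []. Qed.
Lemma op_mulE (f g : E) u : val (f * g) u = val f (val g u). Proof. by []. Qed.
Lemma op_addE (f g : E) u : val (f + g) u = val f u + val g u.
Proof. by []. Qed.
Lemma op_oppE (f : E) u : val (- f) u = - val f u. Proof. by []. Qed.
Lemma op_scaleE k (f : E) u : val (k *: f) u = k *: val f u. Proof. by []. Qed.

End EndAlgebra.

(** * Linear independence of the monomials y^s x^r z^t *)

Section Representation.
Variables (K : fieldType) (q : K).
Hypotheses (q0 : q != 0) (qq1 : q * q - 1 != 0).

Definition lattice_fun := int -> nat -> nat -> K^o.
Local Notation V := lattice_fun.
HB.instance Definition _ := GRing.Lmodule.on V.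

Definition delta (s : int) (r t : nat) : V :=
  fun s' r' t' => [&& s' == s, r' == r & t' == t]%:R.

Fact delta_neq0 : delta 0 0 0 != 0.
Proof.
apply/eqP => /(congr1 (fun f : V => f 0 0%N 0%N)).
by move/eqP; rewrite /delta /= oner_eq0.
Qed.

(** z y^s has leading term w(s) y^s z, and x y^s has leading term
w(s)^-1 y^s x. *)
Let w (s : int) : K := (q ^+ 2) ^ s.

Let w_neq0 s : w s != 0.
Proof. by rewrite expfz_neq0 ?expf_neq0. Qed.

Let w0 : w 0 = 1. Proof. by rewrite /w expr0z. Qed.
Let wS s : w (s + 1) = w s * q ^+ 2.
Proof. by rewrite /w expfzDr ?expf_neq0 // expr1z. Qed.
Let wP s : w (s - 1) = w s * q ^- 2.
Proof. by rewrite /w expfzDr ?expf_neq0 // exprN1. Qed.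

(** With delta (s, r, t) in the role of y^s x^r z^t, these are the formulas
x y^s = w(s)^-1 y^s x + (1 - w(s)^-1) y^(s-1),
z y^s = w(s) y^s z + (1 - w(s)) y^(s-1),
z x^r = q^(-2r) x^r z + (1 - q^(-2r)) x^(r-1),
read off on the coefficients of a possibly infinite combination: the value at
(s, r, t) collects the terms whose index is moved to (s, r, t). *)
Definition x_act (f : V) : V := fun s r t =>
  (w s)^-1 * (if r is r'.+1 then f s r' t else 0)
  + (1 - (w (s + 1))^-1) * f (s + 1) r t.
Definition y_act (f : V) : V := fun s => f (s - 1).
Definition yV_act (f : V) : V := fun s => f (s + 1).
Definition z_act (f : V) : V := fun s r t =>
  w s * q ^- 2 ^+ r * (if t is t'.+1 then f s r t' else 0)
  + w s * (1 - q ^- 2 ^+ r.+1) * f s r.+1 t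
  + (1 - w (s + 1)) * f (s + 1) r t.

Lemma lattice_funP (f g : V) : (forall s r t, f s r t = g s r t) -> f = g.
Proof. by move=> fg; do 3![apply: funext => ?]; apply: fg. Qed.

Lemma lattice_fun_addE (f g : V) s r t : (f + g) s r t = f s r t + g s r t.
Proof. by []. Qed.
Lemma lattice_fun_oppE (f : V) s r t : (- f) s r t = - f s r t.
Proof. by []. Qed.
Lemma lattice_fun_scaleE k (f : V) s r t : (k *: f) s r t = k * f s r t.
Proof. by []. Qed.

Fact x_act_linear : linear x_act.
Proof.
move=> k f g; apply: lattice_funP => s [|r] t;
  by rewrite /x_act !(lattice_fun_addE, lattice_fun_scaleE); ring.
Qed.
Fact y_act_linear : linear y_act. Proof. by []. Qed.
Fact yV_act_linear : linear yV_act. Proof. by []. Qed.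
Fact z_act_linear : linear z_act.
Proof.
move=> k f g; apply: lattice_funP => s r [|t];
  by rewrite /z_act !(lattice_fun_addE, lattice_fun_scaleE); ring.
Qed.

Local Notation E := (linear_op delta_neq0).
Let X : E := mk_op delta_neq0 x_act_linear.
Let Y : E := mk_op delta_neq0 y_act_linear.
Let YV : E := mk_op delta_neq0 yV_act_linear.
Let Z : E := mk_op delta_neq0 z_act_linear.

Let bracket_act (f g : E) : (forall u s r t,
   q * val f (val g u) s r t - q^-1 * val g (val f u) s r t
     = (q - q^-1) * u s r t) ->
  qbracket q q f g = 1.
Proof.
move=> fg; apply: op_eqP => u; apply: lattice_funP => s r t.
rewrite /qbracket !(op_scaleE, op_addE, op_oppE, op_mulE, op_oneE).
rewrite !(lattice_fun_scaleE, lattice_fun_addE, lattice_fun_oppE).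
have h0 : q - q^-1 != 0.
  have -> : q - q^-1 = (q * q - 1) * q^-1 by field.
  by rewrite mulf_neq0 ?invr_eq0.
by rewrite fg mulKf.
Qed.

Lemma lattice_rels : {in Uq_rels q X Y YV Z, forall r, r.1 = r.2}.
Proof.
move=> r; rewrite !inE.
case/or4P => [/eqP->|/eqP->|/eqP->|/orP[]/eqP->] /=.
- apply: op_eqP => u; apply: lattice_funP => s r' t.
  by rewrite op_mulE op_oneE /= /y_act /yV_act subrK.
- apply: op_eqP => u; apply: lattice_funP => s r' t.
  by rewrite op_mulE op_oneE /= /y_act /yV_act addrK.
- apply: bracket_act => u s [|r'] t;
  rewrite /= /x_act /y_act ?addrK ?subrK ?wS ?wP;
  by field; rewrite ?q0 ?w_neq0.
- apply: bracket_act => u s r' [|t];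
  rewrite /= /z_act /y_act ?addrK ?subrK ?wS ?wP;
  by field; rewrite ?q0 ?w_neq0.
- apply: bracket_act => u s [|r'] [|t]; rewrite /= /x_act /z_act ?exprS ?wS;
  by field; rewrite ?q0 ?w_neq0.
Qed.

(** First z, then x, then y is applied while the letters to the left of it have
exponent 0, so that every lower term carries a factor 1 - w(0) or 1 - q^0. *)
Lemma delta_monomial (s r t : nat) :
  val (Y ^+ s * X ^+ r * Z ^+ t) (delta 0 0 0) = delta s r t.
Proof.
have powS (f : E) n u : val (f ^+ n.+1) u = val f (val (f ^+ n) u).
  by rewrite exprS op_mulE.
have Zt : val (Z ^+ t) (delta 0 0 0) = delta 0 0 t.
  elim: t => // t IH; rewrite powS IH; apply: lattice_funP => s' r' [|t'].
    rewrite /= /z_act /delta; case: (s' + 1 =P 0) => [->|_] /=.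
      by rewrite w0 !(andbF, mulr0, subrr, mul0r, addr0).
    by rewrite !(andbF, mulr0, addr0).
  rewrite /= /z_act /delta eqSS; case: (s' + 1 =P 0) => [->|_] /=.
    by rewrite w0 subrr mul0r andbF !mulr0 !addr0; case: eqP => [->|];
      case: eqP => [->|]; rewrite ?mulr0 // w0 expr0 !mul1r.
  rewrite andbF !mulr0 !addr0.
  by case: eqP => [->|]; case: eqP => [->|]; rewrite ?mulr0 // w0 expr0 !mul1r.
have Xr : val (X ^+ r) (delta 0 0 t) = delta 0 r t.
  elim: r => // r IH; rewrite powS IH; apply: lattice_funP => s' [|r'] t'.
    rewrite /= /x_act /delta; case: (s' + 1 =P 0) => [->|_] /=.
      by rewrite w0 invr1 subrr mulr0 mul0r addr0 andbF.
    by rewrite !mulr0 addr0 andbF.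
  rewrite /= /x_act /delta eqSS; case: (s' + 1 =P 0) => [->|_] /=.
    rewrite w0 invr1 subrr mul0r addr0.
    by case: eqP => [->|]; rewrite ?mulr0 // w0 invr1 mul1r.
  by rewrite mulr0 addr0; case: eqP => [->|]; rewrite ?mulr0 // w0 invr1 mul1r.
rewrite !op_mulE Zt Xr; elim: s => // s IH; rewrite powS IH.
by apply: lattice_funP => s' r' t'; rewrite /= /y_act /delta subr_eq -addn1.
Qed.

Lemma Uq_lattice_module : exists X Y YV Z : linear_op delta_neq0,
  {in Uq_rels q X Y YV Z, forall r, r.1 = r.2} /\
  forall s r t : nat,
    val (Y ^+ s * X ^+ r * Z ^+ t) (delta 0 0 0) = delta s r t.
Proof.
by exists X, Y, YV, Z; split; [apply: lattice_rels | apply: delta_monomial].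
Qed.

End Representation.

Section UqBasis.
Variables (K : fieldType) (q : K) (q0 : q != 0) (q2 : q ^+ 2 != 1).

(** Linear independence in the form of dual linear forms: phi i is the value at
i of the action on the delta function at the origin. *)
Lemma Uq_coordinates : exists phi : nat * nat * nat -> Uq q0 q2 -> K^o,
  (forall i, linear (phi i)) /\
  forall i s r t, phi i (Uq_y q0 q2 ^+ s * Uq_x q0 q2 ^+ r * Uq_z q0 q2 ^+ t)
                  = (i == (s, r, t))%:R.
Proof.
have qq1 : q * q - 1 != 0 by rewrite -expr2 subr_eq0.
have [X [Y [YV [Z [XYZ_rels XYZ_delta]]]]] := Uq_lattice_module q0 qq1.
pose b (i : 'I_4) := nth X [:: X; Y; YV; Z] i.
have brel :
  {in Uq_presentation q, forall r, free_eval b r.1 = free_eval b r.2}.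
  move=> r /(map_f (fun r => (free_eval b r.1, free_eval b r.2))).
  rewrite map_Uq_rels /= !free_evalE.
  exact: (XYZ_rels (_, _)).
have [rho rhoE] := pres_alg_lift (Uq_proper q0 q2) brel.
exists (fun i u => val (rho u) (delta K 0 0 0) (Posz i.1.1) i.1.2 i.2).
split.
  move=> i k u v.
  have rhoL : rho (k *: u + v) = k *: rho u + rho v by rewrite linearP.
  rewrite rhoL op_addE op_scaleE.
  by rewrite lattice_fun_addE lattice_fun_scaleE.
move=> [[s' r'] t'] s r t.
have rhoM : rho (Uq_y q0 q2 ^+ s * Uq_x q0 q2 ^+ r * Uq_z q0 q2 ^+ t)
   = Y ^+ s * X ^+ r * Z ^+ t.
  rewrite [LHS]rmorphM [X in X * _]rmorphM !rmorphXn.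
  congr (_ ^+ _ * _ ^+ _ * _ ^+ _);
    [exact: (rhoE 1) | exact: (rhoE 0) | exact: (rhoE 3)].
rewrite rhoM XYZ_delta.
by rewrite /delta !xpair_eqE andbA.
Qed.

End UqBasis.

(** The families indexing a linear combination may repeat an index; coordinates
are insensitive to this, because they recover v as the sum of phi i v times
word i over any duplicate-free list containing the indices in use. *)
Lemma in_span_dual (K : fieldType) (V : lmodType K) (I : eqType)
    (word : I -> V) (P : I -> Prop) (phi : I -> V -> K^o) :
    (forall i, linear (phi i)) ->
    (forall i j, P j -> phi i (word j) = (i == j)%:R) ->
  {in in_span (fun v => exists i, P i /\ v = word i), forall v,
    (forall i, phi i v = 0) -> v = 0}.
Proof.
move=> phiL phiE v vS phi0.
suff [s vs] : exists s, v = \sum_(i <- s) phi i v *: word i.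
  by rewrite vs big1 // => i _; rewrite phi0 scale0r.
move: vS => /in_spanP[l lS ->] {v phi0}.
have [s us sP] : exists2 s : seq I, uniq s &
    {in l, forall p, exists2 j, j \in s & P j /\ p.2 = word j}.
  elim: l lS => [|p l IH] lS; first by exists [::].
  have [|s _ sP] := IH; first by move=> r rl; apply: lS; rewrite inE rl orbT.
  have [j jE] := lS p (mem_head _ _).
  exists (undup (j :: s)); first exact: undup_uniq.
  move=> r; rewrite inE => /predU1P[->|/sP[i si iE]].
    by exists j; rewrite ?mem_undup ?mem_head.
  by exists i; rewrite // mem_undup inE si orbT.
exists s; elim: l sP {lS} => [|p l IH] sP.
  rewrite !big_nil; rewrite big1 // => i _.
  have := phiL i (-1) 0 0.
  by rewrite scaler0 addr0 scaleN1r addNr => ->; rewrite scale0r.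
rewrite big_cons; under [RHS]eq_bigr do rewrite phiL scalerDl -scalerA.
rewrite big_split /= -scaler_sumr; congr (_ *: _ + _); last first.
  by apply: IH => r rl; apply: sP; rewrite inE rl orbT.
have [j js [Pj ->]] := sP p (mem_head _ _).
rewrite (bigD1_seq j) //= phiE // eqxx scale1r big1 ?addr0 // => i ij.
by rewrite phiE // (negbTE ij) scale0r.
Qed.

(** * The isomorphism *)

Lemma rmorph_even_word (R R' : nzRingType) (f : {rmorphism R -> R'})
    (x2 y2 z2 yx yz xz : R) s r t :
  f (even_word x2 y2 z2 yx yz xz s r t) =
  even_word (f x2) (f y2) (f z2) (f yx) (f yz) (f xz) s r t.
Proof.
rewrite /even_word /even_word_xz.
case: odd; last by rewrite !rmorphM !rmorphXn.
by case: r => [|r]; rewrite !rmorphM !rmorphXn.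
Qed.

Lemma even_word_monomial (R : nzRingType) (x y z : R) s r t :
  ~~ odd (s + r + t) ->
  even_word (x ^+ 2) (y ^+ 2) (z ^+ 2) (y * x) (y * z) (x * z) s r t =
  y ^+ s * x ^+ r * z ^+ t.
Proof.
have half (u : R) n : u ^+ n = (u ^+ 2) ^+ n./2 * u ^+ odd n.
  by rewrite -exprM mul2n -exprD addnC odd_double_half.
have xzE m n : odd m = odd n ->
    even_word_xz (x ^+ 2) (z ^+ 2) (x * z) m n = x ^+ m * z ^+ n.
  move=> mn; rewrite /even_word_xz [x ^+ m]half -mulrA; congr (_ * _).
  rewrite [z ^+ n in RHS](_ : _ = z ^+ odd n * (z ^+ 2) ^+ n./2); last first.
    by rewrite -exprM mul2n -exprD odd_double_half.
  by rewrite -mn; case: odd; rewrite ?mul1r // !expr1 mulrA.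
rewrite /even_word !oddD [y ^+ s]half; case os: (odd s) => /=; last first.
  by rewrite negb_add => /eqP rt; rewrite xzE // mulr1 mulrA.
case: r => [|r] /=.
  case: t => //= t; rewrite !negbK => ot.
  by rewrite xzE /= ?(negbTE ot) // expr0 mul1r mulr1 expr1 (exprS z) !mulrA.
by rewrite negbK negb_add => /eqP rt; rewrite xzE // (exprS x) expr1 !mulrA.
Qed.

(** Factors x^2 are split off on the left and z^2 on the right, which leaves
x^i y^s z^k with i, k at most 1.  There x and z are paired with a neighbouring
y, or with each other if s = 0, and the remaining y form pairs. *)
Lemma xyz_even_monomial (R : nzRingType) (P : {pred R}) (x y z : R) :
    1 \in P -> {in P &, forall u v, u * v \in P} ->
    {subset [:: x ^+ 2; y ^+ 2; z ^+ 2; x * y; y * z; x * z] <= P} ->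
  forall r s t, ~~ odd (r + s + t) -> x ^+ r * y ^+ s * z ^+ t \in P.
Proof.
move=> P1 Pmul Pgen.
have PM u v : u \in P -> v \in P -> u * v \in P by apply: Pmul.
have PX u n : u \in P -> u ^+ n \in P.
  by move=> uP; elim: n => // n IH; rewrite exprS PM.
have [Px2 Py2 Pz2] : [/\ x ^+ 2 \in P, y ^+ 2 \in P & z ^+ 2 \in P].
  by split; apply: Pgen; rewrite !inE eqxx ?orbT.
have [Pxy Pyz Pxz] : [/\ x * y \in P, y * z \in P & x * z \in P].
  by split; apply: Pgen; rewrite !inE eqxx ?orbT.
move=> r s t.
have halfl (u : R) n : u ^+ n = (u ^+ 2) ^+ n./2 * u ^+ odd n.
  by rewrite -exprM mul2n -exprD addnC odd_double_half.
have halfr (u : R) n : u ^+ n = u ^+ odd n * (u ^+ 2) ^+ n./2.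
  by rewrite -exprM mul2n -exprD odd_double_half.
rewrite !oddD (halfl x) (halfr z) => rst.
suff mid : x ^+ odd r * y ^+ s * z ^+ odd t \in P.
  set u := (x ^+ 2) ^+ r./2; set v := (z ^+ 2) ^+ t./2.
  have -> : u * x ^+ odd r * y ^+ s * (z ^+ odd t * v)
          = u * (x ^+ odd r * y ^+ s * z ^+ odd t) * v by rewrite !mulrA.
  exact: (PM _ _ (PM _ _ (PX _ _ Px2) mid) (PX _ _ Pz2)).
case: (odd r) (odd t) rst => [] [] /=; rewrite ?addbT ?addbF ?negbK /= => os.
- case: s os => [|s] os; first by rewrite mulr1.
  move: os; rewrite /= negbK => os; rewrite (exprS y) (halfl y) os !expr1.
  have -> : x * (y * ((y ^+ 2) ^+ s./2 * y)) * z
          = (x * y) * (y ^+ 2) ^+ s./2 * (y * z) by rewrite !mulrA.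
  exact: (PM _ _ (PM _ _ Pxy (PX _ _ Py2)) Pyz).
- by rewrite (halfr y) os !expr1 mulr1 mulrA; apply: (PM _ _ Pxy (PX _ _ Py2)).
- by rewrite (halfl y) os !expr1 mul1r -mulrA; apply: (PM _ _ (PX _ _ Py2) Pyz).
- by rewrite (halfl y) (negbTE os) !mulr1 mul1r PX.
Qed.

Section Presentation.
Variables (K : fieldType) (q : K) (q0 : q != 0) (q2 : q ^+ 2 != 1).
Local Notation U := (Uq q0 q2).
Local Notation A := (Aeven q0 q2).
Local Notation inA := (@in_A K q q0 q2).
Local Notation x := (Uq_x q0 q2).
Local Notation y := (Uq_y q0 q2).
Local Notation z := (Uq_z q0 q2).

Let qq1 : q * q - 1 != 0. Proof. by rewrite -expr2 subr_eq0. Qed.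

Let xy1 : qbracket q q x y = 1. Proof. by case: (Uq_relsE q0 q2). Qed.
Let yz1 : qbracket q q y z = 1. Proof. by case: (Uq_relsE q0 q2). Qed.
Let zx1 : qbracket q q z x = 1. Proof. by case: (Uq_relsE q0 q2). Qed.

(** A name of its own lets the inclusion carry the structure of algebra
morphism. *)
Definition Aeven_incl : A -> U := val.

Fact Aeven_incl_linear : linear Aeven_incl.
Proof. exact: linearP. Qed.

Fact Aeven_incl_monoid_morphism : monoid_morphism Aeven_incl.
Proof. by split; [exact: rmorph1 | exact: rmorphM]. Qed.

HB.instance Definition _ :=
  GRing.isLinear.Build K A U *:%R Aeven_incl Aeven_incl_linear.
HB.instance Definition _ :=
  GRing.isMonoidMorphism.Build A U Aeven_incl Aeven_incl_monoid_morphism.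

Let in_A_nu (k : K) (u v : U) : u * v \in inA -> k *: (1 - u * v) \in inA.
Proof.
move=> uvA; rewrite scalerBr -scaleNr; apply: in_spanD; apply: in_spanZ => //.
by apply: mem_in_span; exists 0%N, 0%N, 0%N; rewrite !mulr1.
Qed.

Fact nu_x_in_A : nu_x q0 q2 \in inA.
Proof.
apply: in_A_nu; apply: mem_in_span.
by exists 0%N, 1%N, 1%N; rewrite mul1r !expr1.
Qed.

Fact nu_y_in_A : nu_y q0 q2 \in inA.
Proof.
(* 1 - zx is not a combination of ordered monomials as it stands, 1 - xz is *)
rewrite nu_yE; apply: in_A_nu; apply: mem_in_span.
by exists 1%N, 0%N, 1%N; rewrite mulr1 !expr1.
Qed.

Fact nu_z_in_A : nu_z q0 q2 \in inA.
Proof.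
apply: in_A_nu; apply: mem_in_span.
by exists 1%N, 1%N, 0%N; rewrite mulr1 !expr1.
Qed.

Lemma Aprime_to_Aeven : exists f : {lrmorphism Aprime q -> A},
  [/\ Aeven_val (f (Aprime_nu_x q)) = nu_x q0 q2,
      Aeven_val (f (Aprime_nu_y q)) = nu_y q0 q2 &
      Aeven_val (f (Aprime_nu_z q)) = nu_z q0 q2].
Proof.
pose nx : A := InAeven nu_x_in_A; pose ny : A := InAeven nu_y_in_A.
pose nz : A := InAeven nu_z_in_A.
have nu_A : {in Aprime_rels q nx ny nz, forall r, r.1 = r.2}.
  move=> r /(map_f (fun r => (Aeven_incl r.1, Aeven_incl r.2))).
  rewrite (map_Aprime_rels Aeven_incl) => rU; apply: val_inj.
  exact: (nu_rels_equitable q0 qq1 xy1 yz1 zx1 rU).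
pose b (i : 'I_3) := nth nx [:: nx; ny; nz] i.
have brel :
  {in Aprime_presentation q, forall r, free_eval b r.1 = free_eval b r.2}.
  move=> r /(map_f (fun r => (free_eval b r.1, free_eval b r.2))).
  rewrite map_Aprime_rels /= !free_evalE.
  exact: (nu_A (_, _)).
have [f fE] := pres_alg_lift (@Aprime_proper K q) brel.
exists f; split.
- exact: (congr1 val (fE 0)).
- exact: (congr1 val (fE 1)).
- exact: (congr1 val (fE 2)).
Qed.

Section Image.
Variable F : {lrmorphism Aprime q -> U}.
Local Notation a := (Aprime_nu_x q).
Local Notation b := (Aprime_nu_y q).
Local Notation c := (Aprime_nu_z q).
Hypotheses (Fx : F a = nu_x q0 q2) (Fy : F b = nu_y q0 q2)
           (Fz : F c = nu_z q0 q2).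

Let F_sq u v : F (sq q u v) = sq q (F u) (F v).
Proof.
by rewrite /sq rmorphB rmorph1; congr (_ - _); exact: (rmorph_qbracket F).
Qed.

Let F_1B k u : F (1 - k *: u) = 1 - k *: F u.
Proof. by rewrite rmorphB rmorph1; congr (_ - _); exact: linearZ_LR. Qed.

Let F_x2 : F (sq q b c) = x ^+ 2.
Proof. by rewrite F_sq Fy Fz (sq_equitable q0 qq1 xy1 yz1 zx1). Qed.
Let F_y2 : F (sq q c a) = y ^+ 2.
Proof. by rewrite F_sq Fz Fx (sq_equitable q0 qq1 yz1 zx1 xy1). Qed.
Let F_z2 : F (sq q a b) = z ^+ 2.
Proof. by rewrite F_sq Fx Fy (sq_equitable q0 qq1 zx1 xy1 yz1). Qed.
Let F_yz : F (1 - q^-1 *: a) = y * z.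
Proof. by rewrite F_1B Fx nu_mulE. Qed.
Let F_xz : F (1 - q *: b) = x * z.
Proof. by rewrite F_1B Fy (nu_mulCE q0 qq1 zx1). Qed.
Let F_yx : F (1 - q *: c) = y * x.
Proof. by rewrite F_1B Fz (nu_mulCE q0 qq1 xy1). Qed.
Let F_xy : F (1 - q^-1 *: c) = x * y.
Proof. by rewrite F_1B Fz nu_mulE. Qed.

Let abc : nu_rels q a b c.
Proof.
move=> r; rewrite -map_Aprime_rels => /mapP[p pr ->].
exact: (pres_rel (@Aprime_proper K q) pr).
Qed.

Let ew := even_word (sq q b c) (sq q c a) (sq q a b)
  (1 - q *: c) (1 - q^-1 *: a) (1 - q *: b).

Let F_ew s r t : ~~ odd (s + r + t) -> F (ew s r t) = y ^+ s * x ^+ r * z ^+ t.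
Proof.
move=> srt; rewrite /ew rmorph_even_word /= F_x2 F_y2 F_z2 F_yx F_yz F_xz.
exact: even_word_monomial.
Qed.

Let is_ew := is_even_word (sq q b c) (sq q c a) (sq q a b)
  (1 - q *: c) (1 - q^-1 *: a) (1 - q *: b).

Let Aprime_span u : u \in in_span is_ew.
Proof.
apply: (@pres_alg_ind _ _ _ (@Aprime_proper K q) (in_span is_ew)).
- exact: in_span_subsemimod_closed.
- exact/mem_in_span/is_even_word1.
move=> i; apply: (even_word_span_mull q0 qq1 abc); rewrite !inE.
case: i => [[|[|[|i]]] i3] //; apply/or3P;
  [apply: Or31 | apply: Or32 | apply: Or33]; apply/eqP;
  congr pres_gen; exact: val_inj.
Qed.

Lemma Aprime_to_Uq_inj : injective F.
Proof.
apply: raddf_inj => u Fu0.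
have [phi [phiL phiE]] := Uq_coordinates q0 q2.
pose word i := ew i.1.1 i.1.2 i.2.
pose P (i : nat * nat * nat) := is_true (~~ odd (i.1.1 + i.1.2 + i.2)).
apply: (@in_span_dual _ _ _ word P (fun i v => phi i (F v))).
- by move=> i k v w; rewrite linearP phiL.
- by move=> i [[s r] t] /F_ew; rewrite /word /= => ->; rewrite phiE.
- have /in_spanP[l lS ->] := Aprime_span u.
  apply/in_spanP; exists l => // p /lS.
  by move=> [s [r [t [srt ->]]]]; exists (s, r, t).
move=> i; rewrite Fu0; have := phiL i (-1) 0 0.
by rewrite scaler0 addr0 scaleN1r addNr.
Qed.

Lemma Aprime_to_Uq_onto_A : {in inA, forall v, exists u, F u = v}.
Proof.
pose P := [pred w : U | `[< exists u, F u = w >]].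
have P_closed : GRing.subsemimod_closed P.
  split; first split; first by apply/asboolP; exists 0; rewrite rmorph0.
    move=> _ _ /asboolP[u <-] /asboolP[w <-]; apply/asboolP.
    by exists (u + w); rewrite rmorphD.
  move=> k _ /asboolP[u <-]; apply/asboolP.
  by exists (k *: u); rewrite linearZ.
have id_linear : linear (fun w : U => w) by [].
move=> v vA; apply/asboolP; apply: (in_span_ind id_linear P_closed _ vA).
move=> _ [r [s [t [rst ->]]]]; apply: xyz_even_monomial rst.
- by apply/asboolP; exists 1; rewrite rmorph1.
- move=> _ _ /asboolP[u <-] /asboolP[w <-]; apply/asboolP.
  by exists (u * w); rewrite rmorphM.
move=> w; rewrite !inE => wE; apply/asboolP; move: wE.
case/or4P => [/eqP->|/eqP->|/eqP->|/or3P[] /eqP->]; eexists;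
  [exact: F_x2 | exact: F_y2 | exact: F_z2
  | exact: F_xy | exact: F_yz | exact: F_xz].
Qed.

End Image.

End Presentation.

Theorem theorem5p13 (K : fieldType) (q : K) (q0 : q != 0) (q2 : q ^+ 2 != 1) :
  exists f : {lrmorphism Aprime q -> Aeven q0 q2},
    [/\ bijective f,
        Aeven_val (f (Aprime_nu_x q)) = nu_x q0 q2,
        Aeven_val (f (Aprime_nu_y q)) = nu_y q0 q2
      & Aeven_val (f (Aprime_nu_z q)) = nu_z q0 q2].
Proof.
have [f [fx fy fz]] := Aprime_to_Aeven q0 q2; exists f; split=> //.
have F_inj := Aprime_to_Uq_inj (F := Aeven_incl (q2 := q2) \o f) fx fy fz.
have F_onto := Aprime_to_Uq_onto_A (F := Aeven_incl (q2 := q2) \o f) fx fy fz.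
have f_onto v : exists u, f u = v.
  by have [u uv] := F_onto _ (valP v); exists u; apply: val_inj.
have [g fgK] := choice f_onto.
by exists g => // u; apply: F_inj; rewrite /= fgK.
Qed.
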